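(* Let $\|\cdot\|$ be a norm on $\mathcal S(\Xi;\mathcal A^\infty)$ with completion $\mathfrak L$. For ${\sf h}\in\mathcal S(\Xi)\setminus\{0\}$ let $\|f\|^M_{\sf h}:=\|M_{\sf h}(f)\|$ for $f\in\mathfrak A^\infty$, and let $\mathfrak L^M_{\sf h}$ be the completion of $(\mathfrak A^\infty,\|\cdot\|^M_{\sf h})$. If for a fixed couple $({\sf h},{\sf k})$ of elements of $\mathcal S(\Xi)\setminus\{0\}$ the operator $R_{{\sf k},{\sf h}}:=M_{\sf k}\widetilde M_{\sf h}:(\mathcal S(\Xi;\mathcal A^\infty),\|\cdot\|)\to(\mathcal S(\Xi;\mathcal A^\infty),\|\cdot\|)$ is bounded, then one gets a continuous dense embedding $\mathfrak L^M_{\sf h}\to\mathfrak L^M_{\sf k}$. So, if $\mathfrak L$ is admissible, i.e. $R_{{\sf k},{\sf h}}$ is bounded for all ${\sf h},{\sf k}\in\mathcal S(\Xi)\setminus\{0\}$, then all the Banach spaces $\{\mathfrak L^M_{\sf h}\mid{\sf h}\in\mathcal S(\Xi)\setminus\{0\}\}$ are isomorphic.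
   Context: Setting. $(\Xi,[\![\cdot,\cdot]\!])$ is a real symplectic vector space of finite dimension $2n$, and $\Theta$ is a strongly continuous action of the additive group $\Xi$ by automorphisms of a (possibly non-commutative) $C^*$-algebra $\mathcal A$. $dX$ denotes the Lebesgue measure on $\Xi$ normalized so that the symplectic Fourier transform $(\mathcal F{\sf f})(X)=\int_\Xi e^{-i[\![X,Y]\!]}{\sf f}(Y)dY$ is unitary in $L^2(\Xi)$ (in symplectic coordinates, $(2\pi)^{-n}$ times the usual Lebesgue measure). $\mathcal A^\infty:=\{f\in\mathcal A\mid X\mapsto\Theta_X(f)\in\mathcal A\text{ is }C^\infty\}$ is a Fréchet space with seminorms $|f|^k_{\mathcal A}=\sum_{|\alpha|=k}\frac1{\alpha!}\|\partial_X^\alpha[\Theta_X(f)]_{X=0}\|_{\mathcal A}$, $k\in\mathbb N$. The notation $\mathfrak A^\infty$ refers to the same vector space (endowed with another product, irrelevant here). $\mathcal S(\Xi;\mathcal A^\infty)=\mathcal S(\Xi;\mathfrak A^\infty)$ is the space of smooth functions $F:\Xi\to\mathcal A^\infty$ that decay rapidly together with all derivatives, with respect to all seminorms of $\mathcal A^\infty$. The canonical map $M:\mathcal S(\Xi;\mathfrak A^\infty)\to\mathcal S(\Xi;\mathcal A^\infty)$, $[M(F)](X):=\int_\Xi e^{-i[\![X,Y]\!]}\Theta_Y[F(Y)]\,dY$, is a linear bijection (the composition of $F\mapsto\Theta_{(\cdot)}[F(\cdot)]$ with the symplectic Fourier transform of vector-valued functions). For ${\sf h}\in\mathcal S(\Xi)\setminus\{0\}$: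 $J_{\sf h}:\mathfrak A^\infty\to\mathcal S(\Xi;\mathfrak A^\infty)$, $[J_{\sf h}(f)](X)={\sf h}(X)f$; $\widetilde J_{\sf h}:\mathcal S(\Xi;\mathfrak A^\infty)\to\mathfrak A^\infty$, $\widetilde J_{\sf h}(F)=\int_\Xi\overline{{\sf h}(Y)}F(Y)dY$; $M_{\sf h}:=M\circ J_{\sf h}:\mathfrak A^\infty\to\mathcal S(\Xi;\mathcal A^\infty)$, a linear injection; $\widetilde M_{\sf h}:=\widetilde J_{\sf h}\circ M^{-1}:\mathcal S(\Xi;\mathcal A^\infty)\to\mathfrak A^\infty$.
   Formalization: The continuous dense embedding is the canonical extension of the identity of A^∞, continuous with dense range and claimed injective only on A^∞: for an arbitrary norm with only R_{k,h} bounded, it may have a kernel on the completion. *)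

(* Defs.v *)
From HB Require Import structures.
From mathcomp Require Import all_boot all_order all_algebra.
From mathcomp Require Import all_classical all_reals all_analysis.
From mathcomp Require Import complex.

Set Implicit Arguments.
Unset Strict Implicit.
Unset Printing Implicit Defensive.

Import Order.TTheory GRing.Theory Num.Theory numFieldNormedType.Exports.

Local Open Scope classical_set_scope.
Local Open Scope ring_scope.
Local Open Scope complex_scope.

(* The library norm of a complex normed space takes its values in R[i];
   rnorm is the same number, read in R. *)
Definition rnorm (R : realType) (V : normedZmodType R[i]) (x : V) : R :=
  complex.Re `|x|.

Section rnorm_theory.
Context (R : realType).

Lemma rnormE (V : normedZmodType R[i]) (x : V) : `|x| = (rnorm x)%:C.
Proof.
rewrite /rnorm; have := normr_ge0 x; case: `|x| => a b /=.
by rewrite lecE /= => /andP[/eqP -> _].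
Qed.

Lemma rnormD (V : normedZmodType R[i]) (x y : V) :
  rnorm (x + y) <= rnorm x + rnorm y.
Proof. by have := ler_normD x y; rewrite !rnormE -rmorphD /= lecR. Qed.

Lemma rnormM (x y : R[i]) : rnorm (x * y) = rnorm x * rnorm y.
Proof. by have := normrM x y; rewrite !rnormE -rmorphM /= => /complexI. Qed.

Lemma rnormZ (V : normedModType R[i]) (c : R[i]) (x : V) :
  rnorm (c *: x) = rnorm c * rnorm x.
Proof. by have := normrZ c x; rewrite !rnormE -rmorphM /= => /complexI. Qed.

Lemma rnorm_ge0 (V : normedZmodType R[i]) (x : V) : 0 <= rnorm x.
Proof. by have := normr_ge0 x; rewrite rnormE -[0]/(0%:C) lecR. Qed.

Lemma rnorm0_eq0 (V : normedZmodType R[i]) (x : V) : rnorm x = 0 -> x = 0.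
Proof. by move=> h; apply/normr0_eq0; rewrite rnormE h. Qed.

End rnorm_theory.

(* A Hausdorff locally convex topology on a complex vector space, given by a
   separating family of seminorms. *)
Record seminorms (R : realType) (V : lmodType R[i]) := Seminorms {
  sn_idx : Type ;
  sn : sn_idx -> V -> R ;
  snD : forall i x y, sn i (x + y) <= sn i x + sn i y ;
  snZ : forall i c x, sn i (c *: x) = rnorm c * sn i x ;
  sn_sep : forall x, (forall i, sn i x = 0) -> x = 0
}.

Section smooth_functions.
Context (R : realType) (Xi : normedModType R) (V : lmodType R[i]).
Variable P : seminorms V.

Definition sn_continuous (g : Xi -> V) :=
  forall x i, (fun y : Xi => sn (s := P) i (g y - g x)) @ x --> (0 : R).

Definition has_dderiv (g : Xi -> V) (x v : Xi) (l : V) :=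
  forall i, (fun t : R => sn (s := P) i
      ((t^-1)%:C *: (g (x + t *: v) - g x) - l)) @ 0^' --> (0 : R).

Definition dderiv (v : Xi) (g : Xi -> V) : Xi -> V :=
  fun x => xget 0 [set l | has_dderiv g x v l].

Fixpoint dderivs (s : seq Xi) (g : Xi -> V) : Xi -> V :=
  if s is v :: s' then dderiv v (dderivs s' g) else g.

Definition smooth (g : Xi -> V) :=
  forall s, sn_continuous (dderivs s g) /\
            forall v x, exists l, has_dderiv (dderivs s g) x v l.

Definition rapidly_decreasing (g : Xi -> V) :=
  forall s (N : nat) i, exists c : R,
    forall x, (1 + `|x|) ^+ N * sn (s := P) i (dderivs s g x) <= c.

Definition schwartz_pred : pred (Xi -> V) :=
  fun g => `[< smooth g /\ rapidly_decreasing g >].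

Record schwartz := Schwartz {
  schwartz_fun :> Xi -> V ;
  _ : schwartz_fun \in schwartz_pred
}.

HB.instance Definition _ := [isSub for schwartz_fun].
HB.instance Definition _ := [Choice of schwartz by <:].

Lemma sn0 i : sn (s := P) i 0 = 0.
Proof.
have := snZ (s := P) i 0 0; rewrite scale0r => ->.
by rewrite /rnorm normr0 mul0r.
Qed.

Lemma snN i x : sn (s := P) i (- x) = sn (s := P) i x.
Proof. by rewrite -scaleN1r snZ /rnorm normrN normr1 mul1r. Qed.

Lemma sn_ge0 i x : 0 <= sn (s := P) i x.
Proof.
have := snD (s := P) i x (- x).
by rewrite subrr sn0 snN -mulr2n pmulrn_lge0.
Qed.

Lemma has_dderiv_unique g x v l l' :
  has_dderiv g x v l -> has_dderiv g x v l' -> l = l'.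
Proof.
move=> h h'; apply/eqP; rewrite -subr_eq0; apply/eqP.
apply: (sn_sep (s := P)) => i; apply/eqP; rewrite eq_le sn_ge0 andbT.
have H := cvgD (h' i) (h i); rewrite addr0 in H.
apply: (cvgr_to_ge (H _)); apply: nearW => t /=.
rewrite fctE /=.
set q := _ *: _.
rewrite (_ : l - l' = (q - l') + - (q - l)); last first.
  by rewrite opprB [RHS]addrC addrA subrK.
by rewrite (le_trans (snD _ _ _))// snN.
Qed.

Lemma has_dderivP c g h x v l l' : has_dderiv g x v l -> has_dderiv h x v l' ->
  has_dderiv (fun y => c *: g y + h y) x v (c *: l + l').
Proof.
move=> dg dh i.
apply: (@squeeze_cvgr _ _ _ _ (cst 0)
  (fun t => rnorm c * sn (s := P) i ((t^-1)%:C *: (g (x + t *: v) - g x) - l)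
   + sn (s := P) i ((t^-1)%:C *: (h (x + t *: v) - h x) - l'))).
- apply: nearW => t /=; rewrite sn_ge0 /=.
  rewrite -snZ; apply: le_trans (snD _ _ _); rewrite le_eqVlt; apply/orP; left.
  apply/eqP; congr (sn _ _).
  rewrite opprD addrACA -scalerBr scalerDr opprD addrACA; congr (_ + _).
  by rewrite [in RHS]scalerBr !scalerA mulrC.
- exact: cvg_cst.
- rewrite -[X in _ --> X]addr0 -[X in _ --> X + _](mulr0 (rnorm c)).
  by apply: cvgD; [apply: cvgM; [exact: cvg_cst|exact: dg]|exact: dh].
Qed.

Lemma dderivE g x v l : has_dderiv g x v l -> dderiv v g x = l.
Proof.
move=> h; rewrite /dderiv; case: xgetP => [y _ hy|/(_ l)//].
exact: has_dderiv_unique hy h.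
Qed.

Lemma smooth_family (D : seq Xi -> Xi -> V) :
    (forall s, sn_continuous (D s)) ->
    (forall s v x, has_dderiv (D s) x v (D (v :: s) x)) ->
  (forall s, dderivs s (D [::]) = D s) /\ smooth (D [::]).
Proof.
move=> Dc Dd.
have DE s : dderivs s (D [::]) = D s.
  elim: s => //= v s ->; apply/funext => x; exact: dderivE.
split=> // s; rewrite DE; split=> // v x; by exists (D (v :: s) x).
Qed.

Lemma smooth_has_dderiv g s v x : smooth g ->
  has_dderiv (dderivs s g) x v (dderivs (v :: s) g x).
Proof. by move=> /(_ s)[_ /(_ v x)[l hl]]; rewrite /= (dderivE hl). Qed.

Lemma sn_continuousP c g h : sn_continuous g -> sn_continuous h ->
  sn_continuous (fun y => c *: g y + h y).
Proof.
move=> cg ch x i.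
apply: (@squeeze_cvgr _ _ _ _ (cst 0)
  (fun y => rnorm c * sn (s := P) i (g y - g x) + sn (s := P) i (h y - h x))).
- apply: nearW => t /=; rewrite sn_ge0 /=.
  rewrite -snZ; apply: le_trans (snD _ _ _); rewrite le_eqVlt; apply/orP; left.
  apply/eqP; congr (sn _ _).
  by rewrite opprD addrACA -scalerBr.
- exact: cvg_cst.
- rewrite -[X in _ --> X]addr0 -[X in _ --> X + _](mulr0 (rnorm c)).
  by apply: cvgD; [apply: cvgM; [exact: cvg_cst|exact: cg]|exact: ch].
Qed.

Lemma dderivsP c g h : smooth g -> smooth h ->
  (forall s, dderivs s (fun y => c *: g y + h y) =
             fun y => c *: dderivs s g y + dderivs s h y) /\
  smooth (fun y => c *: g y + h y).
Proof.
move=> sg sh.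
apply: (@smooth_family (fun s y => c *: dderivs s g y + dderivs s h y)).
  by move=> s; apply: sn_continuousP; [case: (sg s)|case: (sh s)].
by move=> s v x; apply: has_dderivP; apply: smooth_has_dderiv.
Qed.

Lemma smooth0 : (forall s, dderivs s (fun=> 0) = fun=> 0) /\
  smooth (fun=> 0).
Proof.
apply: (@smooth_family (fun _ _ => 0)) => [_ x i|_ v x i].
  by under eq_fun do rewrite subrr sn0; exact: cvg_cst.
by under eq_fun do rewrite subrr scaler0 subrr sn0; exact: cvg_cst.
Qed.

Lemma schwartz_submod_closed : submod_closed schwartz_pred.
Proof.
split=> [|c g h /asboolP[sg rg] /asboolP[sh rh]]; apply/asboolP.
  have [e s0] := smooth0; split=> // s N i.
  by exists 0 => x; rewrite e sn0 mulr0.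
have [e s1] := dderivsP c sg sh; split=> // s N i.
have [a ha] := rg s N i; have [b hb] := rh s N i.
exists (rnorm c * a + b) => x; rewrite e.
have N0 : 0 <= (1 + `|x|) ^+ N by rewrite exprn_ge0 // addr_ge0.
apply: (le_trans (ler_wpM2l N0 (snD _ _ _))).
by rewrite mulrDr snZ mulrCA lerD // ler_wpM2l // rnorm_ge0.
Qed.

HB.instance Definition _ :=
  GRing.isSubmodClosed.Build _ _ schwartz_pred schwartz_submod_closed.
HB.instance Definition _ := [SubChoice_isSubLmodule of schwartz by <:].

End smooth_functions.

Section norm_seminorms.
Context (R : realType) (V : normedModType R[i]).

Definition norm_seminorms : seminorms V :=
  @Seminorms R V unit (fun=> @rnorm R V) (fun=> @rnormD R V)
    (fun=> @rnormZ R V) (fun x h => rnorm0_eq0 (h tt)).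

End norm_seminorms.

Section scalar_seminorms.
Context (R : realType).

Definition scalar_seminorms : seminorms R[i]^o :=
  @Seminorms R R[i]^o unit (fun=> @rnorm R R[i]) (fun=> @rnormD R R[i])
    (fun=> @rnormM R) (fun x h => rnorm0_eq0 (h tt)).

End scalar_seminorms.

Notation "''S' ( Xi )" := (schwartz Xi (scalar_seminorms _))
  (at level 8, format "''S' ( Xi )").

Record cstar_structure (R : realType) (A : completeNormedModType R[i]) :=
  CstarStructure {
  cmul : A -> A -> A ;
  cstar : A -> A ;
  cmulA : associative cmul ;
  cmulDl : left_distributive cmul +%R ;
  cmulDr : right_distributive cmul +%R ;
  cmulZl : forall (c : R[i]) x y, cmul (c *: x) y = c *: cmul x y ;
  cmulZr : forall (c : R[i]) x y, cmul x (c *: y) = c *: cmul x y ;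
  cmul_norm : forall x y, `|cmul x y| <= `|x| * `|y| ;
  cstarK : involutive cstar ;
  cstarD : {morph cstar : x y / x + y} ;
  cstarZ : forall (c : R[i]) x, cstar (c *: x) = (c^*)%C *: cstar x ;
  cstarM : forall x y, cstar (cmul x y) = cmul (cstar y) (cstar x) ;
  cstar_norm : forall x, `|cmul (cstar x) x| = `|x| ^+ 2
}.

(* Each act X is bijective, with inverse act (- X). *)
Record cstar_action (R : realType) (Xi : normedModType R)
    (A : completeNormedModType R[i]) (SA : cstar_structure A) := CstarAction {
  act :> Xi -> A -> A ;
  act0 : forall f, act 0 f = f ;
  actD : forall X Y f, act (X + Y) f = act X (act Y f) ;
  act_linear : forall X (c : R[i]) f g,
    act X (c *: f + g) = c *: act X f + act X g ;
  actM : forall X f g, act X (cmul SA f g) = cmul SA (act X f) (act X g) ;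
  act_star : forall X f, act X (cstar SA f) = cstar SA (act X f) ;
  act_continuous : forall f, continuous (act ^~ f)
}.

Section smooth_vectors.
Context (R : realType) (Xi : normedModType R) (A : completeNormedModType R[i]).
Context (SA : cstar_structure A) (Theta : cstar_action Xi SA).

Let PA := norm_seminorms A.

Definition ainf_pred : pred A := fun f => `[< smooth PA (Theta ^~ f) >].

Record ainf := Ainf { ainf_val :> A ; _ : ainf_val \in ainf_pred }.

HB.instance Definition _ := [isSub for ainf_val].
HB.instance Definition _ := [Choice of ainf by <:].

Lemma act_linE (c : R[i]) f g :
  (Theta ^~ (c *: f + g)) = (fun X => c *: Theta X f + Theta X g).
Proof. by apply/funext => X; rewrite act_linear. Qed.

Lemma act_zero X : Theta X 0 = 0.
Proof.
by have := act_linear Theta X (-1) 0 0; rewrite scaler0 addr0 scaleN1r addNr.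
Qed.

Lemma ainf_submod_closed : submod_closed ainf_pred.
Proof.
split=> [|c f g /asboolP sf /asboolP sg]; apply/asboolP.
  rewrite (_ : Theta ^~ 0 = fun=> 0); first by case: (smooth0 Xi PA).
  by apply/funext => X; exact: act_zero.
by rewrite act_linE; case: (dderivsP c sf sg).
Qed.

HB.instance Definition _ :=
  GRing.isSubmodClosed.Build _ _ ainf_pred ainf_submod_closed.
HB.instance Definition _ := [SubChoice_isSubLmodule of ainf by <:].

Lemma ainf_smooth (f : ainf) : smooth PA (Theta ^~ (f : A)).
Proof. by apply/asboolP; exact: valP f. Qed.

Section seminorms_of_ainf.
Context (m : nat) (e : 'I_m -> Xi).

(* A multi-index of weight k has all its entries at most k. *)
Definition ainf_sn (k : nat) (f : ainf) : R :=
  \sum_(a : {ffun 'I_m -> 'I_k.+1} | (\sum_i (a i : nat) == k)%N)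
    ((\prod_i (a i)`!)%N%:R)^-1 *
    rnorm (dderivs PA (flatten [seq nseq (a i) (e i) | i <- enum 'I_m])
             (Theta ^~ (f : A)) 0).

Lemma ainf_snD k f g : ainf_sn k (f + g) <= ainf_sn k f + ainf_sn k g.
Proof.
rewrite /ainf_sn -big_split /=; apply: ler_sum => a _.
rewrite -mulrDr ler_wpM2l ?invr_ge0 //.
set s := flatten _; have /= := act_linE 1 (f : A) (g : A).
rewrite scale1r => ->.
have [-> _] := dderivsP 1 (ainf_smooth f) (ainf_smooth g).
by rewrite scale1r; exact: rnormD.
Qed.

Lemma ainf_snZ k c f : ainf_sn k (c *: f) = rnorm c * ainf_sn k f.
Proof.
rewrite /ainf_sn mulr_sumr; apply: eq_bigr => a _; rewrite mulrCA.
set s := flatten _; congr (_ * _).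
have -> : Theta ^~ (c *: f : ainf) = fun X => c *: Theta X (f : A) + 0.
  by apply/funext => X; rewrite -(act_zero X) -act_linear addr0.
have [z0 sz] := smooth0 Xi PA.
have [-> _] := dderivsP c (ainf_smooth f) sz.
by rewrite z0 addr0; exact: rnormZ.
Qed.

Lemma ainf_sn_sep f : (forall k, ainf_sn k f = 0) -> f = 0.
Proof.
move=> /(_ 0%N); rewrite /ainf_sn (bigD1 [ffun=> ord0]) /=; last first.
  by rewrite big1 // => i _; rewrite ffunE.
rewrite [X in _ + X]big1 ?addr0; last first.
  move=> a /andP[_ /eqP[]]; apply/ffunP => i; rewrite ffunE.
  by apply/val_inj => /=; case: (a i) => -[].
rewrite big1; last by move=> i _; rewrite ffunE.
rewrite invr1 mul1r (_ : flatten _ = [::]) /=; last first.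
  by elim: (enum _) => //= i s ->; rewrite ffunE.
by rewrite act0 => /rnorm0_eq0 f0; exact: val_inj.
Qed.

Definition ainf_seminorms : seminorms ainf :=
  Seminorms ainf_snD ainf_snZ ainf_sn_sep.

End seminorms_of_ainf.
End smooth_vectors.

Section scalar_times_vector.
Context (R : realType) (Xi : normedModType R) (V : lmodType R[i]).
Variable P : seminorms V.

Lemma schwartz_scale (h : 'S(Xi)) (f : V) :
  (fun X => (h X : R[i]) *: f) \in schwartz_pred (Xi := Xi) P.
Proof.
have /asboolP[sh rh] := valP h.
pose D s X := (dderivs (scalar_seminorms R) s h X : R[i]) *: f.
have [DE sD] : (forall s, dderivs P s (D [::]) = D s) /\ smooth P (D [::]).
  apply: smooth_family => [s x i|s v x i].
    have [/(_ x tt) /= c _] := sh s.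
    under eq_fun do rewrite -scalerBl snZ.
    have := cvgM c (cvg_cst (sn (s := P) i f)).
    by rewrite mul0r; apply.
  have /(_ tt) /= c := smooth_has_dderiv s v x sh.
  under eq_fun do rewrite -scalerBl scalerA -scalerBl snZ.
  have := cvgM c (cvg_cst (sn (s := P) i f)).
  by rewrite mul0r; apply.
apply/asboolP; split=> // s N i; rewrite DE.
have [c hc] := rh s N tt.
exists (c * sn (s := P) i f) => x.
by rewrite snZ mulrA ler_wpM2r ?sn_ge0.
Qed.

Definition schwartz_tensor (h : 'S(Xi)) (f : V) : schwartz Xi P :=
  Schwartz (schwartz_scale h f).

End scalar_times_vector.

Section bochner.
Context (R : realType) (d : measure_display) (T : measurableType d).
Context (V : normedModType R[i]) (mu : set T -> \bar R).

(* The list [:: (E_1, a_1); ...] stands for the simple function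
   \sum_j 1_(E_j) a_j. *)
Definition simple_fun (l : seq (set T * V)) (x : T) : V :=
  \sum_(p <- l) (\1_(p.1) x : R)%:C *: p.2.

Definition simple_integral (l : seq (set T * V)) : V :=
  \sum_(p <- l) (fine (mu p.1))%:C *: p.2.

Definition is_bochner_integral (f : T -> V) (v : V) :=
  exists s : nat -> seq (set T * V),
    [/\ forall k p, p \in s k -> measurable p.1 /\ (mu p.1 < +oo)%E,
        forall k, measurable_fun setT (fun x => rnorm (f x - simple_fun (s k) x)),
        (fun k => \int[mu]_x (rnorm (f x - simple_fun (s k) x))%:E)%E @ \oo
          --> (0 : \bar R) &
        (fun k => simple_integral (s k)) @ \oo --> v].

End bochner.

Fixpoint lebesgue_tuple (R : realType) (m : nat) : set (m.-tuple R) -> \bar R :=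
  match m with
  | 0 => fun E => \d_[tuple] E
  | m'.+1 => pushforward (@lebesgue_measure R \x @lebesgue_tuple R m')%E
               (fun xt => [tuple of xt.1 :: xt.2])
  end.

Section symplectic.
Context (R : realType) (Xi : normedModType R) (n : nat).
Variables (sigma : Xi -> Xi -> R) (e : 'I_(n + n) -> Xi).

Record symplectic_form : Prop := SymplecticForm {
  sympl_linear : forall (c : R) X Y Z,
    sigma (c *: X + Y) Z = c * sigma X Z + sigma Y Z ;
  sympl_alternating : forall X, sigma X X = 0 ;
  sympl_nondegenerate : forall X, (forall Y, sigma X Y = 0) -> X = 0
}.

(* These relations make e free, so Xi has dimension n + n. *)
Record symplectic_basis : Prop := SymplecticBasis {
  sympl_ll : forall i j, sigma (e (lshift n i)) (e (lshift n j)) = 0 ;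
  sympl_rr : forall i j, sigma (e (rshift n i)) (e (rshift n j)) = 0 ;
  sympl_lr : forall i j, sigma (e (lshift n i)) (e (rshift n j)) = (i == j)%:R ;
  sympl_span : forall X, exists c : 'I_(n + n) -> R, X = \sum_i c i *: e i
}.

Definition of_coords (t : (n + n).-tuple R) : Xi := \sum_i tnth t i *: e i.

Definition dXi (E : set ((n + n).-tuple R)) : \bar R :=
  (((2 * pi) ^- n)%:E * lebesgue_tuple E)%E.

Definition is_integral (V : normedModType R[i]) (f : Xi -> V) (v : V) :=
  is_bochner_integral dXi (f \o of_coords) v.

End symplectic.

(* expNi s is exp (- i s). *)
Definition expNi (R : realType) (s : R) : R[i] := cos s -i* sin s.

Section canonical_maps.
Context (R : realType) (n : nat) (Xi : normedModType R).
Variables (sigma : Xi -> Xi -> R) (e : 'I_(n + n) -> Xi).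
Context (A : completeNormedModType R[i]) (SA : cstar_structure A).
Variable Theta : cstar_action Xi SA.

Definition schwartz_ainf := schwartz Xi (ainf_seminorms Theta e).
HB.instance Definition _ := GRing.Lmodule.on schwartz_ainf.

(* In the three definitions by xget 0 below, there is exactly one element with
   the stated property (Bochner integrals are unique), and xget returns it. *)
Definition Mmap (F : schwartz_ainf) : schwartz_ainf :=
  xget 0 [set G : schwartz_ainf | forall X,
    is_integral e (fun Y => expNi (sigma X Y) *: Theta Y (F Y : A)) (G X : A)].

Definition Minv (G : schwartz_ainf) : schwartz_ainf :=
  xget 0 [set F : schwartz_ainf | Mmap F = G].

Definition Jmap (h : 'S(Xi)) (f : ainf Theta) : schwartz_ainf :=
  schwartz_tensor (ainf_seminorms Theta e) h f.

Definition Jtilde (h : 'S(Xi)) (F : schwartz_ainf) : ainf Theta :=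
  xget 0 [set v : ainf Theta |
    is_integral e (fun Y => ((h Y : R[i])^*)%C *: (F Y : A)) (v : A)].

Definition Mh (h : 'S(Xi)) : ainf Theta -> schwartz_ainf := Mmap \o Jmap h.

Definition Mtilde (h : 'S(Xi)) : schwartz_ainf -> ainf Theta :=
  Jtilde h \o Minv.

Definition Rmap (k h : 'S(Xi)) : schwartz_ainf -> schwartz_ainf :=
  Mh k \o Mtilde h.

Definition normM (N : schwartz_ainf -> R) (h : 'S(Xi)) (f : ainf Theta) : R :=
  N (Mh h f).

End canonical_maps.

Record is_norm (R : realType) (V : lmodType R[i]) (N : V -> R) : Prop := IsNorm {
  is_normD : forall x y, N (x + y) <= N x + N y ;
  is_normZ : forall (c : R[i]) x, N (c *: x) = rnorm c * N x ;
  is_norm_eq0 : forall x, N x = 0 -> x = 0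
}.

Definition bounded_op (R : realType) (V : lmodType R[i]) (N : V -> R)
  (T : V -> V) := exists c : R, forall x, N (T x) <= c * N x.

Definition admissible (R : realType) (n : nat) (Xi : normedModType R)
    (sigma : Xi -> Xi -> R) (e : 'I_(n + n) -> Xi)
    (A : completeNormedModType R[i]) (SA : cstar_structure A)
    (Theta : cstar_action Xi SA) (N : schwartz_ainf e Theta -> R) :=
  forall h k : 'S(Xi), h <> 0 -> k <> 0 -> bounded_op N (Rmap sigma k h).

Section completions.
Context (R : realType) (V : lmodType R[i]).

(* The completion of (V, N), unique up to a unique isometric isomorphism. *)
Record is_completion (N : V -> R) (L : completeNormedModType R[i])
    (iota : {linear V -> L}) : Prop := IsCompletion {
  completion_isometry : forall x, rnorm (iota x) = N x ;
  completion_dense : dense (range iota)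
}.

Context (L1 L2 : completeNormedModType R[i]).
Variables (iota1 : {linear V -> L1}) (iota2 : {linear V -> L2}).

(* The canonical map between two completions of V extends the identity of V.
   Injectivity is asked on the dense subspace V only: when one norm dominates
   another on V, the map between the completions can have a kernel. *)
Record dense_embedding (T : {linear L1 -> L2}) : Prop := DenseEmbedding {
  demb_continuous : continuous T ;
  demb_id : forall x, T (iota1 x) = iota2 x ;
  demb_inj : {in range iota1 &, injective T} ;
  demb_dense : dense (range T)
}.

Record banach_iso (T : {linear L1 -> L2}) : Prop := BanachIso {
  biso_continuous : continuous T ;
  biso_id : forall x, T (iota1 x) = iota2 x ;
  biso_inverse : exists T' : {linear L2 -> L1},
    [/\ continuous T', cancel T T' & cancel T' T]
}.

End completions.

(* Main.v *)
(** Since M is injective, R_{k,h} M_h f = M_k (J~_h J_h f) = |h|^2 M_k f, where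
    |h| is the L^2 norm of h. Boundedness of R_{k,h} therefore says that the norm
    of index k is dominated by the norm of index h on the smooth vectors, and the
    identity of the smooth vectors extends to the completions.

    The constant |h|^2 is a Bochner integral over the coordinates of Xi in the
    basis e. It is finite because the coordinates are bounded by the norm of Xi,
    which requires e to be free. The hypotheses on sigma alone do not give this,
    since sigma is only assumed linear in its first variable; it follows from
    the injectivity of M. Indeed, if e were not free, then the norm of
    Theta_Y (h(Y) f), as a function of the coordinates of Y, would be invariant
    under a nonzero translation, hence not integrable unless it vanishes, and the
    integrals defining M (J_h f) and M (J_h (2 f)) would both diverge. *)
Require Import Defs.
From HB Require Import structures.
From mathcomp Require Import all_boot all_order all_algebra finmap.
From mathcomp Require Import all_classical all_reals all_analysis.
From mathcomp Require Import measurable_realfun complex lra.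

Set Implicit Arguments.
Unset Strict Implicit.
Unset Printing Implicit Defensive.

Import Order.TTheory GRing.Theory Num.Theory numFieldNormedType.Exports.
Local Open Scope classical_set_scope.
Local Open Scope ring_scope.
Local Open Scope complex_scope.

(** * Norms and dense extension *)

Section rnorm_facts.
Context {R : realType}.

Lemma rnormr0 (V : normedZmodType R[i]) : rnorm (0 : V) = 0.
Proof. by rewrite /rnorm normr0. Qed.

Lemma rnormN (V : normedZmodType R[i]) (x : V) : rnorm (- x) = rnorm x.
Proof. by rewrite /rnorm normrN. Qed.

Lemma rnormB (V : normedZmodType R[i]) (x y : V) : rnorm (x - y) = rnorm (y - x).
Proof. by rewrite -rnormN opprB. Qed.

Lemma rnorm_real (r : R) : rnorm (r%:C : R[i]) = `|r|.
Proof. by rewrite /rnorm normc_def /= expr0n addr0 sqrtr_sqr. Qed.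

(** Balls in a complex normed space have radii in [R[i]], where the order forces a positive element
    to be real; epsilon arguments can therefore be run in [R]. *)
Lemma ltc_pos_real (e : R[i]) : 0 < e -> exists2 r : R, 0 < r & e = r%:C.
Proof.
case: e => a b; rewrite ltcE /= => /andP[/eqP -> a0]; by exists a.
Qed.

Lemma rnorm_small_eq0 (V : normedModType R[i]) (x : V) :
  (forall eps : R, 0 < eps -> rnorm x <= eps) -> x = 0.
Proof.
move=> h; apply: rnorm0_eq0; apply/eqP; rewrite eq_le rnorm_ge0 andbT.
by apply/ler_addgt0Pl => e e0; rewrite addr0 h.
Qed.

Lemma cvg_rnormP (V : normedModType R[i]) (u : nat -> V) (l : V) :
  u @ \oo --> l <-> (fun k => rnorm (u k - l)) @ \oo --> (0 : R).
Proof.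
split=> [h|h].
  apply/cvgrPdist_lt => e e0.
  have e0' : 0 < e%:C by rewrite -[0]/(0%:C) ltcR.
  move/cvgrPdist_lt: h => /(_ _ e0'); apply: filterS => n.
  by rewrite rnormE ltcR rnormB sub0r normrN ger0_norm ?rnorm_ge0.
apply/cvgrPdist_lt => _ /ltc_pos_real [e e0 ->].
move/cvgrPdist_lt: h => /(_ _ e0); apply: filterS => n.
by rewrite sub0r normrN ger0_norm ?rnorm_ge0 // rnormE ltcR rnormB.
Qed.

Lemma ler_dist_rnorm (V : normedZmodType R[i]) (x y : V) :
  `|rnorm x - rnorm y| <= rnorm (x - y).
Proof.
have h1 := rnormD (x - y) y; have h2 := rnormD (y - x) x.
rewrite !subrK (rnormB y) in h1 h2.
by rewrite ler_norml lerBlDr h1 lerNl opprB lerBlDr h2.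
Qed.

End rnorm_facts.

Section dense_extension.
Context {R : realType}.

Lemma dense_range_approx (V : Type) (L : normedModType R[i]) (i : V -> L) :
  dense (range i) ->
  forall y (eps : R), 0 < eps -> exists x, rnorm (i x - y) < eps.
Proof.
move=> d y eps e0.
have e0' : 0 < eps%:C by rewrite -[0]/(0%:C) ltcR.
have [|z [/= hz [x _ xz]]] := d (ball y eps%:C) _ (ball_open _ _).
  by exists y; exact: ballxx.
exists x; move: hz; rewrite -xz -ball_normE /= rnormE ltcR.
by rewrite rnormB.
Qed.

Lemma rnorm_bounded_continuous (L1 L2 : normedModType R[i])
    (T : {linear L1 -> L2}) (C : R) :
  (forall y, rnorm (T y) <= C * rnorm y) -> continuous T.
Proof.
move=> TC; apply/linear_bounded_continuous/linear_boundedP.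
exists `|C|%:C; split.
  by rewrite realE -[0]/(0%:C) lecR normr_ge0.
move=> r Cr x; apply: (@le_trans _ _ (`|C|%:C * `|x|)); last first.
  by rewrite ler_wpM2r // ltW.
rewrite !rnormE -rmorphM lecR (le_trans (TC x)) //.
by rewrite ler_wpM2r ?rnorm_ge0 // ler_norm.
Qed.

(** The relation [ext] is the closure of the graph sending [i1 x] to [i2 x]. It is stable under
    linear combinations, the bound makes it single-valued, and completeness of [L2] makes it total;
    the extension is the function with this graph. *)
Lemma dense_linear_extension (V : lmodType R[i])
    (L1 L2 : completeNormedModType R[i])
    (i1 : {linear V -> L1}) (i2 : {linear V -> L2}) (C : R) :
  dense (range i1) -> (forall x, rnorm (i2 x) <= C * rnorm (i1 x)) ->
  exists T : {linear L1 -> L2}, continuous T /\ forall x, T (i1 x) = i2 x.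
Proof.
move=> d1; wlog C0 : C / 0 < C => [H hC|hC].
  apply: (H (`|C| + 1)); first by rewrite ltr_pwDr.
  move=> x; rewrite (le_trans (hC x)) // ler_wpM2r ?rnorm_ge0 //.
  by rewrite (le_trans (ler_norm _)) // lerDl.
have ap := dense_range_approx d1.
pose ext y z := forall eps : R, 0 < eps ->
  exists x, rnorm (i1 x - y) < eps /\ rnorm (i2 x - z) < eps.
have ext_i x : ext (i1 x) (i2 x).
  by move=> eps e0; exists x; rewrite !subrr !rnormr0.
have extP c y z y' z' : ext y z -> ext y' z' -> ext (c *: y + y') (c *: z + z').
  (* With this radius the errors on the two terms add up to [rnorm c * r + r = eps]. *)
  move=> h h' eps e0; pose r := eps / (rnorm c + 1).
  have c1 : 0 < rnorm c + 1 by rewrite ltr_wpDl ?rnorm_ge0.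
  have r0 : 0 < r by rewrite divr_gt0.
  have [x [a b]] := h r r0; have [x' [a' b']] := h' r r0.
  have est (L : normedModType R[i]) (u u' v v' : L) :
      rnorm (u - v) < r -> rnorm (u' - v') < r ->
      rnorm (c *: u + u' - (c *: v + v')) < eps.
    move=> hu hv; rewrite opprD addrACA -scalerBr.
    apply: (le_lt_trans (rnormD _ _)); rewrite rnormZ.
    rewrite (_ : eps = rnorm c * r + r); last first.
      by rewrite -[X in _ + X]mul1r -mulrDl mulrC divfK // gt_eqF.
    by rewrite ler_ltD // ler_wpM2l ?rnorm_ge0 // ltW.
  by exists (c *: x + x'); rewrite (linearP i1) (linearP i2); split; exact: est.
have ext_le y z : ext y z -> rnorm z <= C * rnorm y.
  (* The error [r] occurs once on the side of [z] and once, multiplied by [C], on the side of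
     [y]. *)
  move=> h; apply/ler_addgt0Pr => eps e0; pose r := eps / (C + 1).
  have C1 : 0 < C + 1 by rewrite addr_gt0.
  have [x [a b]] := h r (divr_gt0 e0 C1).
  have h1 := rnormD (i2 x) (z - i2 x); rewrite addrC subrK in h1.
  apply: (le_trans h1).
  have h2 := rnormD y (i1 x - y); rewrite addrC subrK in h2.
  rewrite rnormB in b.
  rewrite (_ : eps = C * r + r); last first.
    by rewrite -[X in _ + X]mul1r -mulrDl mulrC divfK // gt_eqF.
  rewrite addrA; apply: lerD (ltW b).
  rewrite (le_trans (hC x)) // -mulrDr ler_pM2l // (le_trans h2) //.
  by rewrite lerD2l ltW.
have ext_uniq y z z' : ext y z -> ext y z' -> z = z'.
  (* Subtracting the two pairs relates [0] to [z' - z], and the bound kills the latter. *)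
  move=> h h'; have := ext_le _ _ (extP (-1) _ _ _ _ h h').
  rewrite !scaleN1r addNr rnormr0 mulr0 => le0.
  apply/eqP; rewrite eq_sym -subr_eq0 addrC; apply/eqP/rnorm0_eq0/eqP.
  by rewrite eq_le rnorm_ge0 le0.
have ext_ex y : exists z, ext y z.
  have pos n : 0 < (n.+1%:R^-1 : R) by rewrite invr_gt0.
  have [x hx] := choice (fun n => ap y _ (pos n)).
  (* The points [i1 (x n)] converge to [y], and the bound turns their Cauchy property into that of
     the [i2 (x n)]. *)
  have cz : cvg (i2 \o x @ \oo).
    apply/cauchy_cvgP/cauchy_exP => _ /ltc_pos_real[eps e0 ->].
    have e1 : 0 < eps / C / 2 by rewrite !divr_gt0.
    have near_y : \forall n \near \oo, rnorm (i1 (x n) - y) < eps / C / 2.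
      near=> n; apply: (lt_trans (hx n)).
      by near: n; exact: near_infty_natSinv_lt (PosNum e1).
    have [N _ hN] := near_y; exists (i2 (x N)).
    rewrite /= nbhs_filterE /fmapE; exists N => // q /hN yq.
    rewrite -ball_normE /= rnormE ltcR -(linearB i2).
    apply: (le_lt_trans (hC _)).
    rewrite mulrC -ltr_pdivlMr // (linearB i1) -[i1 (x N)](subrK y) -addrA.
    apply: (le_lt_trans (rnormD _ _)); rewrite [ltRHS]splitr ltrD //.
      exact: (hN N (leqnn N)).
    by rewrite rnormB.
  exists (lim (i2 \o x @ \oo)) => eps e0.
  have /cvg_rnormP/cvgrPdist_lt/(_ _ e0) near_z := cz.
  near \oo => n; exists (x n); split.
    apply: (lt_trans (hx n)).
    by near: n; exact: near_infty_natSinv_lt (PosNum e0).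
  have : `|0 - rnorm ((i2 \o x) n - lim (i2 \o x @ \oo))| < eps by near: n.
  by rewrite sub0r normrN ger0_norm ?rnorm_ge0.
have [T hT] := choice ext_ex.
have T_lin : linear T.
  by move=> c y y'; apply: ext_uniq _ _ _ (hT _) (extP _ _ _ _ _ (hT _) (hT _)).
pose Tl := GRing.isLinear.Build _ _ _ _ T T_lin.
pose TL : {linear L1 -> L2} := HB.pack T Tl.
exists TL; split=> [|x]; last exact: ext_uniq _ _ _ (hT _) (ext_i _).
by apply: (@rnorm_bounded_continuous _ _ _ C) => y; exact: ext_le _ _ (hT y).
Unshelve. all: by end_near. Qed.

End dense_extension.

(** * Bochner integrals *)

Section bochner_integral.
Context {R : realType} {d : measure_display} {T : measurableType d}.
Context {V : normedModType R[i]} (mu : {measure set T -> \bar R}).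
Implicit Types (l : seq (set T * V)) (E : set T) (b : V).

Lemma simple_fun_cons p l x : simple_fun (p :: l) x =
  (if x \in p.1 then p.2 else 0) + simple_fun l x.
Proof.
rewrite /simple_fun big_cons indicE; congr (_ + _).
by case: ifP => _; rewrite /= ?scale1r ?scale0r.
Qed.

(** The norm of a sum is not determined by the norms of its terms, so the induction carries an
    offset [b], which absorbs the vector of each set that contains the point. *)
Lemma measurable_rnorm_simple_fun b l :
  (forall p, p \in l -> measurable p.1) ->
  measurable_fun setT (fun x => rnorm (b + simple_fun l x)).
Proof.
elim: l b => [|p l IH] b hl.
  by under eq_fun do rewrite /simple_fun big_nil; exact: measurable_cst.
have hl' q : q \in l -> measurable q.1.
  by move=> ql; apply: hl; rewrite inE ql orbT.
rewrite (_ : (fun _ => _) = fun x => if x \in p.1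
    then rnorm ((b + p.2) + simple_fun l x) else rnorm (b + simple_fun l x)).
  apply: measurable_fun_ifT; [|exact: IH|exact: IH].
  apply: (measurable_fun_bool true); rewrite setTI.
  rewrite (_ : _ @^-1` _ = p.1); first by apply: hl; rewrite mem_head.
  by apply/seteqP; split=> x /= => [/set_mem|/mem_set].
apply/funext => x; rewrite simple_fun_cons.
by case: ifP => _; rewrite ?add0r ?addrA.
Qed.

(** The sets of the list may overlap. Induction cuts [E] along the first set; on each piece the
    first term is constant and joins the offset [b], so the triangle inequality is only used between
    disjoint pieces. *)
Lemma rnorm_simple_integral_on b l E :
  (forall p, p \in l -> measurable p.1) -> measurable E -> (mu E < +oo)%E ->
  ((rnorm ((fine (mu E))%:C *: b +
     \sum_(p <- l) (fine (mu (p.1 `&` E)))%:C *: p.2))%:E <=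
   \int[mu]_(x in E) (rnorm (b + simple_fun l x))%:E)%E.
Proof.
have fin F G : measurable F -> measurable G -> (mu F < +oo)%E -> G `<=` F ->
    mu G \is a fin_num.
  move=> mF mG Fo GF; rewrite ge0_fin_numE //.
  by apply: le_lt_trans Fo; rewrite le_measure ?inE.
elim: l b E => [|p l IH] b E hl mE Eoo.
  rewrite big_nil addr0; under eq_integral do rewrite /simple_fun big_nil addr0.
  rewrite integral_cst // rnormZ rnorm_real ger0_norm ?fine_ge0 //.
  by rewrite mulrC EFinM fineK // (fin E).
have mp : measurable p.1 by apply: hl; rewrite mem_head.
have hl' q : q \in l -> measurable q.1.
  by move=> ql; apply: hl; rewrite inE ql orbT.
pose E1 := p.1 `&` E; pose E2 := E `\` p.1.
have mE1 : measurable E1 by exact: measurableI.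
have mE2 : measurable E2 by exact: measurableD.
have EE : E = E1 `|` E2.
  apply/seteqP; split=> [x Ex|x [[]|[]] //].
  by have [px|npx] := pselect (p.1 x); [left|right].
have dE : E1 `&` E2 = set0.
  by apply/seteqP; split=> x // [[px _] [_]].
have E1E : E1 `<=` E by move=> x [].
have E2E : E2 `<=` E by move=> x [].
have E1oo : (mu E1 < +oo)%E by rewrite -ge0_fin_numE // (fin E).
have E2oo : (mu E2 < +oo)%E by rewrite -ge0_fin_numE // (fin E).
have split_mu q : measurable q ->
    fine (mu (q `&` E)) = fine (mu (q `&` E1)) + fine (mu (q `&` E2)).
  move=> mq; rewrite {1}EE setIUr measureU.
  - by rewrite fineD // (fin E) //; try exact: measurableI;
      apply: subset_trans (@subIsetr _ _ _) _.
  - exact: measurableI.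
  - exact: measurableI.
  - by rewrite setIACA dE setI0.
have muE : fine (mu E) = fine (mu E1) + fine (mu E2).
  by have := split_mu setT measurableT; rewrite !setTI.
have mfE F : measurable_fun F (EFin \o (fun x => rnorm (b + simple_fun (p :: l) x))).
  apply: measurable_funTS; apply/measurable_EFinP.
  exact: measurable_rnorm_simple_fun.
rewrite [X in (\int[mu]_(x in X) _)%E]EE ge0_integral_setU //; last 2 first.
- by move=> x _; rewrite lee_fin rnorm_ge0.
- by apply/disj_setPS; rewrite dE.
rewrite (_ : (\int[mu]_(x in E1) _)%E =
    (\int[mu]_(x in E1) (rnorm ((b + p.2) + simple_fun l x))%:E)%E); last first.
  by apply: eq_integral => x /set_mem[px _]; rewrite simple_fun_cons mem_set // addrA.
rewrite (_ : (\int[mu]_(x in E2) (rnorm (b + simple_fun (p :: l) x))%:E)%E =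
    (\int[mu]_(x in E2) (rnorm (b + simple_fun l x))%:E)%E); last first.
  by apply: eq_integral => x /set_mem[_ px]; rewrite simple_fun_cons memNset // add0r.
apply: le_trans (leeD (IH _ _ hl' mE1 E1oo) (IH _ _ hl' mE2 E2oo)).
rewrite -EFinD lee_fin; apply: le_trans (rnormD _ _).
rewrite le_eqVlt; apply/orP; left; apply/eqP; congr rnorm.
rewrite big_cons muE rmorphD /= scalerDl scalerDr.
rewrite (_ : \sum_(q <- l) (fine (mu (q.1 `&` E)))%:C *: q.2 =
    \sum_(q <- l) (fine (mu (q.1 `&` E1)))%:C *: q.2 +
    \sum_(q <- l) (fine (mu (q.1 `&` E2)))%:C *: q.2); last first.
  rewrite -big_split /= !big_seq; apply: eq_bigr => q /hl' mq.
  by rewrite split_mu // rmorphD scalerDl.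
by rewrite [RHS]addrACA [_ + _ *: p.2 + _]addrAC !addrA.
Qed.

Lemma rnorm_simple_integral l :
  (forall p, p \in l -> measurable p.1 /\ (mu p.1 < +oo)%E) ->
  ((rnorm (simple_integral mu l))%:E <=
   \int[mu]_x (rnorm (simple_fun l x))%:E)%E.
Proof.
move=> hl; have mf := measurable_rnorm_simple_fun 0 (fun p pl => (hl p pl).1).
(* Intersecting the sets of the list with such an [E] leaves them unchanged, so the local bound on
   [E] is the one sought. *)
have [E [mE Eoo lE]] : exists E, [/\ measurable E, (mu E < +oo)%E &
    forall p, p \in l -> p.1 `<=` E].
  elim: l hl {mf} => [|p l IH] hl.
    by exists set0; split=> //; rewrite measure0 ltry.
  have [|E [mE Eoo lE]] := IH; first by move=> q ql; apply: hl; rewrite inE ql orbT.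
  have [mp poo] := hl p (mem_head _ _).
  exists (p.1 `|` E); split; first exact: measurableU.
    by rewrite (le_lt_trans (measureU2 _ _ _)) // lte_add_pinfty.
  move=> q; rewrite inE => /predU1P[->|/lE qE]; first exact: subsetUl.
  exact: subset_trans qE (@subsetUr _ _ _).
have := rnorm_simple_integral_on 0 (fun p pl => (hl p pl).1) mE Eoo.
rewrite scaler0 add0r; under eq_integral do rewrite add0r.
rewrite big_seq (eq_bigr (fun p => (fine (mu p.1))%:C *: p.2)); last first.
  by move=> p pl; rewrite (setIidl (lE p pl)).
rewrite -big_seq => /le_trans; apply; apply: ge0_subset_integral => //.
- by apply/measurable_EFinP; under eq_fun do rewrite -[simple_fun _ _]add0r.
- by move=> x _; rewrite lee_fin rnorm_ge0.
Qed.

(** The difference of two approximating simple functions is a simple function, whose integral is at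
    most the sum of the two L^1 errors; both errors tend to zero. *)
Lemma bochner_integral_unique (f : T -> V) v v' :
  is_bochner_integral mu f v -> is_bochner_integral mu f v' -> v = v'.
Proof.
move=> [s [hs ms Is cs]] [s' [hs' ms' Is' cs']].
apply/eqP; rewrite -subr_eq0; apply/eqP/rnorm_small_eq0 => eps e0.
pose opp (l : seq (set T * V)) := [seq (p.1, - p.2) | p <- l].
have diff_fun k x : simple_fun (s k ++ opp (s' k)) x =
    simple_fun (s k) x - simple_fun (s' k) x.
  rewrite /simple_fun big_cat big_map /= -sumrN; congr (_ + _).
  by apply: eq_bigr => p _; rewrite scalerN.
have diff_int k : simple_integral mu (s k ++ opp (s' k)) =
    simple_integral mu (s k) - simple_integral mu (s' k).
  rewrite /simple_integral big_cat big_map /= -sumrN; congr (_ + _).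
  by apply: eq_bigr => p _; rewrite scalerN.
have le_int k : ((rnorm (simple_integral mu (s k) - simple_integral mu (s' k)))%:E <=
    \int[mu]_x (rnorm (f x - simple_fun (s k) x))%:E +
    \int[mu]_x (rnorm (f x - simple_fun (s' k) x))%:E)%E.
  have hd p : p \in s k ++ opp (s' k) -> measurable p.1 /\ (mu p.1 < +oo)%E.
    by rewrite mem_cat => /orP[/hs //|/mapP[q /hs' hq ->]].
  rewrite -diff_int (le_trans (rnorm_simple_integral hd)) //.
  rewrite -ge0_integralD //; first last.
  - by apply/measurable_EFinP.
  - by move=> x _; rewrite lee_fin rnorm_ge0.
  - by apply/measurable_EFinP.
  - by move=> x _; rewrite lee_fin rnorm_ge0.
  apply: ge0_le_integral => //.
  - by move=> x _; rewrite lee_fin rnorm_ge0.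
  - apply/measurable_EFinP; under eq_fun do rewrite -[simple_fun _ _]add0r.
    by apply: measurable_rnorm_simple_fun => p /hd[].
  - by apply: emeasurable_funD; exact/measurable_EFinP.
  - move=> x _; rewrite -EFinD lee_fin diff_fun (rnormB (f x) (simple_fun (s k) x)).
    by apply: le_trans (rnormD _ _); rewrite addrA subrK.
(* One quarter goes to each limit of integrals and one to each L^1 error. *)
have e4 : 0 < eps / 4 by rewrite divr_gt0.
have small (u : nat -> \bar R) : u @ \oo --> 0%E ->
    \forall k \near \oo, (u k < (eps / 4)%:E)%E.
  move=> /fine_cvgP[fu /cvgrPdist_lt /(_ _ e4) du]; near=> k.
  rewrite -[u k]fineK; last by near: k.
  have : `|0 - (fine \o u) k| < eps / 4 by near: k.
  rewrite lte_fin /= sub0r normrN; exact: le_lt_trans (ler_norm _).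
have /cvg_rnormP/cvgrPdist_lt/(_ _ e4) near_v := cs.
have /cvg_rnormP/cvgrPdist_lt/(_ _ e4) near_v' := cs'.
have near_I := small _ Is.
have near_I' := small _ Is'.
near \oo => k.
have a1 : rnorm (v - simple_integral mu (s k)) < eps / 4.
  rewrite rnormB -[rnorm _]ger0_norm ?rnorm_ge0 // -normrN -sub0r.
  by near: k.
have a2 : rnorm (simple_integral mu (s' k) - v') < eps / 4.
  rewrite -[rnorm _]ger0_norm ?rnorm_ge0 // -normrN -sub0r.
  by near: k.
have a3 : rnorm (simple_integral mu (s k) - simple_integral mu (s' k)) <
    eps / 4 + eps / 4.
  rewrite -lte_fin (le_lt_trans (le_int k)) // EFinD.
  by apply: lteD; near: k.
have -> : v - v' = (v - simple_integral mu (s k)) +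
    (simple_integral mu (s k) - simple_integral mu (s' k)) +
    (simple_integral mu (s' k) - v') by rewrite !addrA !subrK.
rewrite (le_trans (rnormD _ _)) // (le_trans (lerD (rnormD _ _) (lexx _))) //.
lra.
Unshelve. all: by end_near. Qed.

End bochner_integral.

Section bochner_scalar.
Context {R : realType} {d : measure_display} {T : measurableType d}.
Context {V : normedModType R[i]} (mu : {measure set T -> \bar R}).

Import HBNNSimple.

(* The height 0 is left out, as its level set may have infinite measure. *)
Definition level_simple (g : {nnsfun T >-> R}) (a : V) : seq (set T * V) :=
  [seq (g @^-1` [set r], r%:C *: a) | r <- fset_set (range g) & r != 0].

Lemma simple_fun_level (g : {nnsfun T >-> R}) a x :
  simple_fun (level_simple g a) x = (g x)%:C *: a.
Proof.
rewrite /simple_fun big_map big_filter fimfunE fsbig_finite //=.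
rewrite rmorph_sum scaler_suml [RHS](bigID (fun r : R => r != 0)) /=.
rewrite [X in _ + X]big1 ?addr0 => [|r /negPn/eqP ->]; last first.
  by rewrite mul0r scale0r.
by apply: eq_bigr => r _; rewrite rmorphM scalerA mulrC.
Qed.

(** This is Chebyshev's inequality: [g] dominates [r] times the indicator of the level set, and [r]
    is positive. *)
Lemma level_set_finite (g : {nnsfun T >-> R}) r :
  (\int[mu]_x (g x)%:E < +oo)%E -> r \in fset_set (range g) -> r != 0 ->
  (mu (g @^-1` [set r]) < +oo)%E.
Proof.
move=> goo + r0; rewrite in_fset_set // => /set_mem[x _ gx].
have r_gt0 : 0 < r by rewrite lt_neqAle eq_sym r0 -gx fun_ge0.
have m_r : measurable (g @^-1` [set r]) by exact: measurable_funPTI.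
have le_r : (r%:E * mu (g @^-1` [set r]) <= \int[mu]_x (g x)%:E)%E.
  rewrite -[X in mu X]setIT -integral_indic // -ge0_integralZl_EFin //; last 2 first.
  - exact/measurable_EFinP/measurable_indic.
  - exact: ltW.
  apply: ge0_le_integral => //.
  - by move=> y _; rewrite -EFinM lee_fin mulr_ge0 // ltW.
  - apply: measurable_funeM; exact/measurable_EFinP/measurable_indic.
  - by apply/measurable_EFinP; exact: measurable_funP.
  - move=> y _; rewrite -EFinM lee_fin indicE.
    case: (boolP (y \in _)) => [/set_mem /= <-|_]; first by rewrite mulr1.
    by rewrite mulr0 fun_ge0.
have := le_lt_trans le_r goo.
by case: (mu _) => [s|//|//]; rewrite ?ltry // gt0_muley ?lte_fin.
Qed.

Lemma simple_integral_level (g : {nnsfun T >-> R}) a :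
  (\int[mu]_x (g x)%:E < +oo)%E ->
  simple_integral mu (level_simple g a) = (fine (\int[mu]_x (g x)%:E))%:C *: a.
Proof.
move=> goo; rewrite /simple_integral big_map big_filter.
rewrite integralT_nnsfun sintegralE fsbig_finite //=.
rewrite [X in fine X](bigID (fun r : R => r != 0)) /=.
rewrite [X in fine (_ + X)]big1 ?addr0; last first.
  by move=> r /negPn/eqP ->; rewrite mul0e.
rewrite big_seq_cond [in RHS]big_seq_cond -sum_fine => [|r /andP[rg r0]].
  rewrite rmorph_sum scaler_suml; apply: eq_bigr => r /andP[rg r0].
  have mu_fin : mu (g @^-1` [set r]) \is a fin_num.
    by rewrite ge0_fin_numE // level_set_finite.
  by rewrite fineM // rmorphM scalerA mulrC.
rewrite fin_numM // ge0_fin_numE //; exact: level_set_finite.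
Qed.

(** Nonnegative simple functions increasing to [g], multiplied by [a], are the approximation. The
    L^1 error is the norm of [a] times the gap between the scalar integrals, which closes by
    monotone convergence. *)
Lemma is_bochner_integral_scale (g : T -> R) (a : V) :
  measurable_fun setT g -> (forall x, 0 <= g x) ->
  (\int[mu]_x (g x)%:E < +oo)%E ->
  is_bochner_integral mu (fun x => (g x)%:C *: a)
    ((fine (\int[mu]_x (g x)%:E))%:C *: a).
Proof.
move=> mg g0 goo.
have mEg : measurable_fun setT (EFin \o g) by exact/measurable_EFinP.
pose gk := nnsfun_approx measurableT mEg.
have gk_le k x : gk k x <= g x.
  by rewrite -lee_fin nnsfun_approxE; apply: le_approx => // y _; rewrite lee_fin.
have mgk k : measurable_fun setT (EFin \o gk k) by exact/measurable_EFinP.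
have gkoo k : (\int[mu]_x (gk k x)%:E < +oo)%E.
  apply: le_lt_trans goo; apply: ge0_le_integral => //.
  - by move=> x _; rewrite lee_fin fun_ge0.
  - exact: mgk.
  - by move=> x _; rewrite lee_fin.
have cvg_gk : (fun k => \int[mu]_x (gk k x)%:E)%E @ \oo --> (\int[mu]_x (g x)%:E)%E.
  rewrite (_ : (\int[mu]_x (g x)%:E)%E =
      (\int[mu]_x (limn (fun k => (gk k x)%:E)))%E); last first.
    apply: eq_integral => x _; apply/esym/cvg_lim => //.
    by apply: cvg_nnsfun_approx => // y _; rewrite lee_fin.
  apply: cvg_monotone_convergence => //.
  - by move=> k x _; rewrite lee_fin fun_ge0.
  - by move=> x _ m n mn; rewrite lee_fin; exact/lefP/nd_nnsfun_approx.
have fin_g : (\int[mu]_x (g x)%:E)%E \is a fin_num.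
  by rewrite ge0_fin_numE // integral_ge0 // => x _; rewrite lee_fin.
have normE k x : rnorm ((g x)%:C *: a - simple_fun (level_simple (gk k) a) x) =
    (g x - gk k x) * rnorm a.
  rewrite simple_fun_level -scalerBl -rmorphB rnormZ rnorm_real ger0_norm //.
  by rewrite subr_ge0.
exists (fun k => level_simple (gk k) a); split.
- move=> k p /mapP[r]; rewrite mem_filter => /andP[r0 rg] -> /=; split.
    exact: measurable_funPTI.
  exact: level_set_finite.
- move=> k; under eq_fun do rewrite normE.
  by apply: measurable_funM => //; exact: measurable_funB.
- rewrite (_ : (fun k => _) = (fun k => (\int[mu]_x (g x)%:E -
      \int[mu]_x (gk k x)%:E) * (rnorm a)%:E)%E); last first.
    apply/funext => k; under eq_integral do rewrite normE EFinM.
    rewrite ge0_integralZr //; last 3 first.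
    + by apply/measurable_EFinP; exact: measurable_funB.
    + by move=> x _; rewrite lee_fin subr_ge0.
    + by rewrite lee_fin rnorm_ge0.
    congr (_ * _)%E; rewrite -integralB_EFin //.
    + apply/integrableP; split=> //.
      by under eq_integral do rewrite /= ger0_norm //.
    + apply/integrableP; split=> //.
      by under eq_integral do rewrite /= ger0_norm ?fun_ge0 //.
  rewrite -[X in _ --> X](mul0e (rnorm a)%:E) -(subee fin_g).
  apply: cvgeZr => //; apply: cvgeB; [|exact: cvg_cst|exact: cvg_gk].
  by rewrite fin_num_adde_defr.
- apply/cvg_rnormP.
  rewrite (_ : (fun k => _) = fun k => `|fine (\int[mu]_x (gk k x)%:E)%E -
      fine (\int[mu]_x (g x)%:E)%E| * rnorm a); last first.
    apply/funext => k; rewrite simple_integral_level //.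
    by rewrite -scalerBl -rmorphB rnormZ rnorm_real.
  rewrite -[X in _ --> X](mul0r (rnorm a)); apply: cvgMl.
  have /fine_cvgP[_] : (fun k => \int[mu]_x (gk k x)%:E)%E @ \oo -->
    (fine (\int[mu]_x (g x)%:E))%:E by rewrite fineK.
  move=> h; rewrite -(normr0 R) -(subrr (fine (\int[mu]_x (g x)%:E))).
  by apply: cvg_norm; apply: cvgB => //; exact: cvg_cst.
Qed.

End bochner_scalar.

Section bochner_norm.
Context {R : realType} {d : measure_display} {T : measurableType d}.
Context {V : normedModType R[i]} (mu : {measure set T -> \bar R}).

Lemma rnorm_simple_fun_integrable (l : seq (set T * V)) :
  (forall p, p \in l -> measurable p.1 /\ (mu p.1 < +oo)%E) ->
  (\int[mu]_x (rnorm (simple_fun l x))%:E < +oo)%E.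
Proof.
have mrn (l' : seq (set T * V)) : (forall p, p \in l' -> measurable p.1 /\ (mu p.1 < +oo)%E) ->
    measurable_fun setT (fun x => rnorm (simple_fun l' x)).
  move=> hl'; have := measurable_rnorm_simple_fun 0 (fun p pl => (hl' p pl).1).
  by under eq_fun do rewrite add0r.
elim: l => [|p l IH] hl.
  under eq_integral do rewrite /simple_fun big_nil rnormr0.
  by rewrite integral0 ltry.
have hl' q : q \in l -> measurable q.1 /\ (mu q.1 < +oo)%E.
  by move=> ql; apply: hl; rewrite inE ql orbT.
have [mp poo] := hl p (mem_head _ _).
have m1 : measurable_fun setT (fun x => (\1_(p.1) x * rnorm p.2)%:E).
  by apply/measurable_EFinP/measurable_funM => //; exact: measurable_indic.
apply: (@le_lt_trans _ _ (\int[mu]_x ((\1_(p.1) x * rnorm p.2)%:E +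
    (rnorm (simple_fun l x))%:E))%E).
  apply: ge0_le_integral => //.
  - by move=> x _; rewrite lee_fin rnorm_ge0.
  - by apply/measurable_EFinP/mrn.
  - by apply: emeasurable_funD => //; apply/measurable_EFinP/mrn.
  - move=> x _; rewrite -EFinD lee_fin simple_fun_cons (le_trans (rnormD _ _)) //.
    rewrite lerD2r indicE; case: ifP => _; first by rewrite mul1r.
    by rewrite rnormr0 mul0r.
rewrite ge0_integralD //; last 3 first.
- by move=> x _; rewrite lee_fin mulr_ge0 ?rnorm_ge0.
- by move=> x _; rewrite lee_fin rnorm_ge0.
- by apply/measurable_EFinP/mrn.
apply: lte_add_pinfty; last exact: IH.
under eq_integral do rewrite EFinM.
rewrite ge0_integralZr ?lee_fin ?rnorm_ge0 //; last first.
  by apply/measurable_EFinP; exact: measurable_indic.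
by rewrite integral_indic // setIT lte_mul_pinfty ?lee_fin ?rnorm_ge0 ?ltry // ge0_fin_numE.
Qed.

(** Some approximating simple function is at finite L^1 distance from [F], and its own norm has a
    finite integral. *)
Lemma bochner_integral_norm_finite (F : T -> V) v :
  measurable_fun setT (fun x => rnorm (F x)) ->
  is_bochner_integral mu F v -> (\int[mu]_x (rnorm (F x))%:E < +oo)%E.
Proof.
move=> mF [s [hs ms Is _]].
have [k Ik] : exists k, (\int[mu]_x (rnorm (F x - simple_fun (s k) x))%:E < +oo)%E.
  have /fine_cvgP[[k _ hk] _] := Is; exists k.
  by have /fin_numPlt/andP[] := hk k (leqnn k).
have mk : measurable_fun setT (fun x => rnorm (simple_fun (s k) x)).
  have := measurable_rnorm_simple_fun 0 (fun p pl => (hs k p pl).1).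
  by under eq_fun do rewrite add0r.
apply: (@le_lt_trans _ _ (\int[mu]_x ((rnorm (F x - simple_fun (s k) x))%:E +
    (rnorm (simple_fun (s k) x))%:E))%E).
  apply: ge0_le_integral => //.
  - by move=> x _; rewrite lee_fin rnorm_ge0.
  - by apply/measurable_EFinP.
  - by apply: emeasurable_funD; apply/measurable_EFinP.
  - move=> x _; rewrite -EFinD lee_fin -{1}[F x](subrK (simple_fun (s k) x)).
    exact: rnormD.
rewrite ge0_integralD //; first exact: (lte_add_pinfty Ik (rnorm_simple_fun_integrable (hs k))).
- by move=> x _; rewrite lee_fin rnorm_ge0.
- by apply/measurable_EFinP.
- by move=> x _; rewrite lee_fin rnorm_ge0.
- by apply/measurable_EFinP.
Qed.

End bochner_norm.

(** * Lebesgue measure on tuples *)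

Section sf_measure.
Context {R : realType} d (T : measurableType d) (mu : {measure set T -> \bar R}).
Hypothesis mu_sf : sigma_finite setT mu.

(** A copy of [mu] that takes the proof of sigma-finiteness as an argument, so that the measure
    instances can be attached to it. *)
Definition sf_measure & sigma_finite setT mu : set T -> \bar R := mu.

HB.instance Definition _ := isMeasure.Build _ _ _ (sf_measure mu_sf)
  (measure0 mu) (measure_ge0 mu) (@measure_semi_sigma_additive _ _ _ mu).
HB.instance Definition _ :=
  Measure_isSigmaFinite.Build _ _ _ (sf_measure mu_sf) mu_sf.

End sf_measure.

Section product_pushforward.
Context {R : realType} d1 d2 d3 (T1 : measurableType d1)
  (T2 : measurableType d2) (T3 : measurableType d3).
Context (m1 : {sigma_finite_measure set T1 -> \bar R})
  (m2 : {sigma_finite_measure set T2 -> \bar R}).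
Context (f : T1 * T2 -> T3) (mf : measurable_fun setT f).

(** The left inverse [g] carries exhausting rectangles over to the target: the preimage under [f] of
    the preimage under [g] of a rectangle is that rectangle again. *)
Lemma sigma_finite_product_pushforward (g : T3 -> T1 * T2) :
  measurable_fun setT g -> cancel f g ->
  exists nu : {sigma_finite_measure set T3 -> \bar R},
    (nu : set T3 -> \bar R) = pushforward (m1 \x m2)%E f.
Proof.
move=> mg fK.
pose nu := measure_function_pushforward__canonical__measure_function_Measure
  (m1 \x m2)%E mf.
have nu_sf : sigma_finite setT nu.
  have /sigma_finiteP[F [FT ndF Foo]] := sigma_finiteT m1.
  have /sigma_finiteP[G [GT ndG Goo]] := sigma_finiteT m2.
  exists (fun k => g @^-1` (F k `*` G k)).
    rewrite -preimage_bigcup -[LHS](preimage_setT g); congr preimage.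
    apply/seteqP; split=> // -[x y] _.
    have [i _ Fx] : (\bigcup_i F i) x by rewrite -FT.
    have [j _ Gy] : (\bigcup_j G j) y by rewrite -GT.
    (* Both exhaustions are increasing, so the larger index serves both factors. *)
    exists (maxn i j) => //; split=> /=.
      by move: x Fx; exact/subsetPset/ndF/leq_maxl.
    by move: y Gy; exact/subsetPset/ndG/leq_maxr.
  move=> k; have [mF Fk] := Foo k; have [mG Gk] := Goo k; split.
    by rewrite -[X in measurable X]setTI; apply: mg => //; exact: measurableX.
  rewrite /= /pushforward (_ : _ @^-1` _ = F k `*` G k); last first.
    by apply/seteqP; split=> xt; rewrite /= fK.
  by rewrite product_measure1E // lte_mul_pinfty // ge0_fin_numE.
by exists (sf_measure nu_sf).
Qed.

Lemma integral_product_pushforward (F : T3 -> \bar R) :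
  measurable_fun setT F -> (forall t, 0 <= F t)%E ->
  (\int[pushforward (m1 \x m2) f]_t F t =
   \int[m1]_x \int[m2]_y F (f (x, y)))%E.
Proof.
move=> mF F0; rewrite ge0_integral_pushforward // preimage_setT.
by rewrite fubini_tonelli1 //=; exact: (measurableT_comp mF mf).
Qed.

End product_pushforward.

Section lebesgue_tuple_measure.
Context {R : realType}.

Let cons_xt m (xt : measurableTypeR R * m.-tuple R) : m.+1.-tuple R := [tuple of xt.1 :: xt.2].

Lemma measurable_cons_tuple m : measurable_fun setT (@cons_xt m).
Proof.
by apply: measurable_cons; [exact: measurable_fst|exact: measurable_snd].
Qed.

(** [lebesgue_tuple] is a bare set function. The induction carries sigma-finiteness along with the
    measure, because forming the product with one more coordinate and applying Tonelli require
    it. *)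
Lemma lebesgue_tuple_measure m :
  exists mu : {sigma_finite_measure set (m.-tuple R) -> \bar R},
    (mu : set (m.-tuple R) -> \bar R) = @lebesgue_tuple R m.
Proof.
elim: m => [|m [mu muE]].
  by exists (dirac ([tuple] : 0.-tuple R)).
pose split_t (t : m.+1.-tuple R) : measurableTypeR R * m.-tuple R :=
  (tnth t ord0, [tuple of behead t]).
have msplit : measurable_fun setT split_t.
  by apply: measurable_fun_pair; [exact: measurable_tnth|exact: measurable_behead].
have consK : cancel (@cons_xt m) split_t.
  by case=> x t; congr pair; apply: val_inj.
rewrite /= -muE.
exact: (sigma_finite_product_pushforward (@lebesgue_measure R) mu
  (@measurable_cons_tuple m) msplit consK).
Qed.

(** By Tonelli the head coordinate splits off; its factor leaves the inner integral, to which the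
    induction hypothesis applies. *)
Lemma lebesgue_tuple_prod m (phi : 'I_m -> R -> R) (c : 'I_m -> R) :
  (forall i, measurable_fun setT (phi i)) -> (forall i x, 0 <= phi i x) ->
  (forall i, \int[lebesgue_measure]_x (phi i x)%:E = (c i)%:E)%E ->
  (\int[@lebesgue_tuple R m]_t (\prod_i phi i (tnth t i))%:E = (\prod_i c i)%:E)%E.
Proof.
elim: m phi c => [|m IH] phi c mphi phi0 hc.
  rewrite -[@lebesgue_tuple R 0]/(dirac ([tuple] : 0.-tuple R)).
  under eq_integral do rewrite big_ord0.
  by rewrite big_ord0 integral_dirac // diracT mul1e.
have [mu muE] := lebesgue_tuple_measure m.
have mprod k (psi : 'I_k -> R -> R) : (forall i, measurable_fun setT (psi i)) ->
    measurable_fun setT (fun t : k.-tuple R => \prod_i psi i (tnth t i)).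
  move=> mpsi; apply: measurable_prod => i _.
  by apply: measurableT_comp; [exact: mpsi|exact: measurable_tnth].
rewrite /= -muE.
rewrite (integral_product_pushforward (@lebesgue_measure R) mu
  (@measurable_cons_tuple m)); last 2 first.
- by apply/measurable_EFinP; exact: (mprod _ phi mphi).
- by move=> t; rewrite lee_fin prodr_ge0.
have prodE (x : R) (t : m.-tuple R) :
    \prod_i phi i (tnth [tuple of x :: t] i) =
    phi ord0 x * \prod_i phi (lift ord0 i) (tnth t i).
  by rewrite big_ord_recl; congr (_ * _); apply: eq_bigr => i _; rewrite tnthS.
have IHm := IH (fun i => phi (lift ord0 i)) (fun i => c (lift ord0 i))
  (fun i => mphi _) (fun i => phi0 _) (fun i => hc _).
rewrite -muE in IHm.
transitivity (\int[lebesgue_measure]_x ((phi ord0 x)%:E * (\prod_i c (lift ord0 i))%:E))%E.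
  apply: eq_integral => x _.
  transitivity (\int[mu]_y ((phi ord0 x)%:E *
      (\prod_i phi (lift ord0 i) (tnth y i))%:E))%E.
    by apply: eq_integral => t _; rewrite prodE EFinM.
  rewrite ge0_integralZl ?IHm //.
  - apply/measurable_EFinP.
    exact: (mprod _ (fun i => phi (lift ord0 i)) (fun i => mphi _)).
  - by move=> t _; rewrite lee_fin prodr_ge0.
  - by rewrite lee_fin.
have c0 i : 0 <= c i.
  by rewrite -lee_fin -hc integral_ge0 // => x _; rewrite lee_fin.
rewrite ge0_integralZr ?hc //.
- by rewrite -EFinM big_ord_recl.
- by apply/measurable_EFinP; exact: (mphi ord0).
- by move=> x _; rewrite lee_fin.
- by rewrite lee_fin prodr_ge0.
Qed.

End lebesgue_tuple_measure.

(** * Measurability of continuous functions of tuples *)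

Section tuple_continuous.
Context {R : realType} {m : nat}.

(* G is the pointwise limit of its values at the grid points below t, and these
   are functions of countably many cells. *)
Lemma measurable_tuple_continuous (G : m.-tuple R -> R) :
  (forall t eps, 0 < eps -> exists2 del, 0 < del & forall t',
    (forall i, `|tnth t' i - tnth t i| < del) -> `|G t' - G t| < eps) ->
  measurable_fun setT G.
Proof.
move=> cG.
pose fl k (t : m.-tuple R) : m.-tuple int :=
  [tuple Num.floor (k.+1%:R * tnth t i) | i < m].
pose grid k (z : m.-tuple int) : m.-tuple R :=
  [tuple (tnth z i)%:~R / k.+1%:R | i < m].
apply: (@measurable_fun_cvg _ _ _ _ (fun k t => G (grid k (fl k t)))) => [k|t _].
  move=> _ Y mY; rewrite setTI.
  rewrite (_ : _ @^-1` _ = \bigcup_(z : m.-tuple int)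
      (if G (grid k z) \in Y then fl k @^-1` [set z] else set0)); last first.
    apply/seteqP; split=> [t /= Yt|t /= [z _]].
      by exists (fl k t) => //; rewrite mem_set.
    by case: ifP => // /set_mem Yz /= ->.
  apply: countable_bigcupT_measurable => // z.
  case: ifP => _; last exact: measurable0.
  rewrite (_ : _ @^-1` _ = \bigcap_(i in [set: 'I_m]) ((@tnth _ R ^~ i) @^-1`
     [set` `[(tnth z i)%:~R / k.+1%:R, (tnth z i + 1)%:~R / k.+1%:R[])); last first.
    have flP (t : m.-tuple R) i : (Num.floor (k.+1%:R * tnth t i) == tnth z i) =
        (tnth t i \in `[(tnth z i)%:~R / k.+1%:R, (tnth z i + 1)%:~R / k.+1%:R[).
      by rewrite floor_eq in_itv /= ler_pdivrMr // ltr_pdivlMr // mulrC.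
    apply/seteqP; split=> [t /= tz i _|t /= h].
      by rewrite /= -flP -tz tnth_mktuple.
    by apply: eq_from_tnth => i; rewrite tnth_mktuple; apply/eqP; rewrite flP h.
  apply: fin_bigcap_measurable => // i _.
  by rewrite -[X in measurable X]setTI; apply: measurable_tnth.
apply/cvgrPdist_lt => eps e0; have [del d0 hd] := cG t eps e0.
near=> k; rewrite distrC; apply: hd => i; rewrite !tnth_mktuple.
have k0 : 0 < k.+1%:R :> R by [].
have /andP[f1 f2] := floor_itv (k.+1%:R * tnth t i).
have dk : k.+1%:R^-1 < del by near: k; exact: near_infty_natSinv_lt (PosNum d0).
rewrite intrD mulrC -ltr_pdivlMr // mulrDl mul1r in f2.
rewrite mulrC -ler_pdivrMr // in f1.
rewrite ltr_norml ltrBlDr; apply/andP; split; last first.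
  by rewrite [k.+1%:R * _]mulrC (le_lt_trans f1) // ltrDr.
by rewrite ltrBrDr addrC ltrBlDr [k.+1%:R * _]mulrC (lt_trans f2) // ltrD2l.
Unshelve. all: by end_near. Qed.

End tuple_continuous.

Section boxes.
Context {R : realType}.
Implicit Types (m : nat) (r : R).

Definition box m (c : 'I_m -> R) r (t : m.-tuple R) : R :=
  [forall i, `|tnth t i - c i| < r]%:R.

Lemma box_ge0 m (c : 'I_m -> R) r t : 0 <= box c r t.
Proof. exact: ler0n. Qed.

Lemma box_prod m (c : 'I_m -> R) r t :
  box c r t = \prod_i \1_(`]c i - r, c i + r[) (tnth t i).
Proof.
have itvP i : (tnth t i \in `]c i - r, c i + r[%classic) = (`|tnth t i - c i| < r).
  by rewrite mem_setE in_itv /= ltr_distl.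
rewrite /box; case: (boolP [forall i, _]) => [/forallP h|].
  by rewrite big1 // => i _; rewrite indicE itvP h.
rewrite negb_forall => /existsP[i hi].
by rewrite (bigD1 i) //= indicE itvP (negbTE hi) mul0r.
Qed.

Lemma measurable_box m (c : 'I_m -> R) r : measurable_fun setT (box c r).
Proof.
rewrite (_ : box c r = fun t => \prod_i \1_(`]c i - r, c i + r[) (tnth t i)).
  apply: measurable_prod => i _.
  by apply: measurableT_comp; [exact: measurable_indic|exact: measurable_tnth].
by apply/funext => t; exact: box_prod.
Qed.

Lemma integral_box m (c : 'I_m -> R) r : 0 < r ->
  (\int[@lebesgue_tuple R m]_t (box c r t)%:E = ((2 * r) ^+ m)%:E)%E.
Proof.
move=> r0.
rewrite (_ : (fun t => (box c r t)%:E) =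
    fun t => (\prod_i \1_(`]c i - r, c i + r[) (tnth t i))%:E); last first.
  by apply/funext => t; rewrite box_prod.
rewrite (@lebesgue_tuple_prod _ _ (fun i => \1_(`]c i - r, c i + r[))
  (fun=> 2 * r)).
- by rewrite prodr_const card_ord.
- by move=> i; exact: measurable_indic.
- by move=> i x; rewrite indicE.
- move=> i; rewrite integral_indic // setIT.
  apply: (etrans (lebesgue_measure_itv `]c i - r, c i + r[)); rewrite /= lte_fin.
  rewrite ltrBlDr -addrA ltrDl addr_gt0 // -EFinB; congr EFin.
  lra.
Qed.

End boxes.

(** * Integrable functions invariant under a translation *)

Section translation_invariance.
Context {R : realType} {m : nat} (W : m.-tuple R -> R).
Hypothesis cW : forall t eps, 0 < eps -> exists2 del, 0 < del & forall t',
  (forall i, `|tnth t' i - tnth t i| < del) -> `|W t' - W t| < eps.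
Hypothesis W_ge0 : forall t, 0 <= W t.

Lemma positive_on_box t : 0 < W t -> exists2 r, 0 < r & forall t',
  (forall i, `|tnth t' i - tnth t i| < r) -> W t / 2 <= W t'.
Proof.
move=> Wt; have W2 : 0 < W t / 2 by rewrite divr_gt0.
have [r r0 hr] := cW t W2.
exists r => // t' /hr; rewrite ltr_distl => /andP[+ _] => /ltW.
by rewrite {1}[W t]splitr addrK.
Qed.

(* W is at least W t / 2 on the disjoint translates along u of a box around t,
   so its integral exceeds every multiple of the volume of that box. *)
Lemma translation_invariant_eq0 (u : m.-tuple R) i0 :
  tnth u i0 != 0 ->
  (forall t s, W [tuple tnth t i + s * tnth u i | i < m] = W t) ->
  (\int[@lebesgue_tuple R m]_t (W t)%:E < +oo)%E -> forall t, W t = 0.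
Proof.
move=> u0 Wu Woo t; apply/eqP; rewrite eq_le W_ge0 andbT leNgt; apply/negP => Wt.
have [r r0 hr] := positive_on_box Wt.
have [mu muE] := @lebesgue_tuple_measure R m; rewrite -muE in Woo.
(* Step [k] shifts the coordinate [i0] by [2 * r * k], which separates the open boxes of radius
   [r]. *)
pose s (k : nat) := 2 * r * k%:R / tnth u i0.
pose c k i := tnth t i + s k * tnth u i.
have c_i0 k : c k i0 = tnth t i0 + 2 * r * k%:R by rewrite /c /s divfK.
have box_disj k k' t' : k != k' ->
    (forall i, `|tnth t' i - c k i| < r) -> ~~ [forall i, `|tnth t' i - c k' i| < r].
  move=> kk' h; apply/negP => /forallP /(_ i0); have := h i0.
  rewrite !c_i0 !ltr_distl => /andP[h1 h2] /andP[h3 h4].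
  have [lt|lt|/eqP] := ltngtP k k'; last by rewrite (negbTE kk').
    have : (k%:R + 1 : R) <= k'%:R by rewrite natr1 ler_nat.
    nra.
  have : (k'%:R + 1 : R) <= k%:R by rewrite natr1 ler_nat.
  nra.
have W_box K t' : W t / 2 * \sum_(k < K) box (c k) r t' <= W t'.
  have [[k hk]|no] := pselect (exists k : 'I_K, forall i, `|tnth t' i - c k i| < r).
    rewrite (bigD1 k) //= big1 ?addr0 => [|k' kk']; last first.
      by rewrite /box (negbTE (box_disj k k' t' _ hk)) // eq_sym.
    rewrite /box (_ : [forall i, _] = true) ?mulr1; last exact/forallP.
    (* Invariance moves [t'] back into the box around [t], where the lower bound is known. *)
    rewrite -(Wu t' (- s k)); apply: hr => i; rewrite tnth_mktuple.
    by have := hk i; rewrite /c opprD addrA mulNr addrAC.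
  rewrite big1 ?mulr0 // => k _; rewrite /box (_ : [forall i, _] = false) //.
  by apply/negbTE/negP => /forallP h; apply: no; exists k.
have int_box k : (\int[mu]_t' (box (c k) r t')%:E = ((2 * r) ^+ m)%:E)%E.
  by have := integral_box (c k) r0; rewrite -muE.
have vol0 : 0 < (2 * r) ^+ m by rewrite exprn_gt0 // mulr_gt0.
have mW : measurable_fun setT W := measurable_tuple_continuous cW.
have le_int K : ((W t / 2 * (K%:R * (2 * r) ^+ m))%:E <= \int[mu]_t' (W t')%:E)%E.
  apply: (@le_trans _ _ (\int[mu]_t' (W t / 2 * \sum_(k < K) box (c k) r t')%:E)%E).
    under eq_integral do rewrite EFinM -sumEFin.
    rewrite ge0_integralZl_EFin; last 4 first.
    - exact: measurableT.
    - by move=> x _; rewrite sume_ge0 // => k _; rewrite lee_fin box_ge0.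
    - by apply: emeasurable_sum => k; apply/measurable_EFinP; exact: measurable_box.
    - by rewrite divr_ge0.
    rewrite ge0_integral_sum //; last 2 first.
    - by move=> k; apply/measurable_EFinP; exact: measurable_box.
    - by move=> k x _; rewrite lee_fin box_ge0.
    rewrite (eq_bigr (fun=> ((2 * r) ^+ m)%:E)) => [|k _]; last exact: int_box.
    by rewrite sumEFin -EFinM sumr_const card_ord mulr_natl.
  apply: ge0_le_integral => //.
  - by move=> x _; rewrite lee_fin mulr_ge0 ?divr_ge0 // sumr_ge0 // => k _; exact: box_ge0.
  - apply/measurable_EFinP/measurable_funM => //.
    by apply: measurable_sum => k; exact: measurable_box.
  - exact/measurable_EFinP.
  - by move=> x _; rewrite lee_fin.
have fin_W : (\int[mu]_t' (W t')%:E)%E \is a fin_num.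
  by rewrite ge0_fin_numE // integral_ge0 // => x _; rewrite lee_fin.
pose I := fine (\int[mu]_t' (W t')%:E)%E.
(* The number of boxes is taken just large enough for their contributions to exceed the finite
   integral [I]. *)
pose K := (Num.truncn (I / (W t / 2 * (2 * r) ^+ m))).+1.
have := le_int K; rewrite -(fineK fin_W) lee_fin leNgt => /negP; apply.
rewrite mulrCA -ltr_pdivrMr ?mulr_gt0 ?divr_gt0 //; exact: truncnS_gt.
Qed.

End translation_invariance.

(** * Coordinates are controlled by the norm *)

Section coordinates.
Context {R : realType} {n : nat} {Xi : normedModType R} (e : 'I_(n + n) -> Xi).

Lemma linear_combination_dist (a b : 'I_(n + n) -> R) (del : R) :
  (forall i, `|a i - b i| <= del) ->
  `|\sum_i a i *: e i - \sum_i b i *: e i| <= del * \sum_i `|e i|.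
Proof.
move=> h; rewrite -sumrB (le_trans (ler_norm_sum _ _ _)) //.
rewrite mulr_sumr; apply: ler_sum => i _.
by rewrite -scalerBl normrZ ler_wpM2r.
Qed.

Lemma coord_le_norm m (v : 'rV[R]_m) i : `|v ord0 i| <= `|v|.
Proof.
rewrite [leRHS]/Num.norm /= mx_normrE; apply/bigmax_geP; right => /=.
by exists (ord0, i).
Qed.

(** This is the equivalence of norms in finite dimension: [f] is continuous, and by freeness
    positive, on the compact unit sphere of coordinate vectors, so it has a positive minimum there;
    homogeneity does the rest. *)
Lemma coords_bounded :
  (forall t, of_coords e t = 0 -> forall i, tnth t i = 0) ->
  exists2 C : R, 0 < C & forall t i, `|tnth t i| <= C * `|of_coords e t|.
Proof.
move=> e_free; pose f (v : 'rV[R]_(n + n)) : R := `|\sum_i v ord0 i *: e i|.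
have f_cont : continuous f.
  move=> v; apply/(@cvgrPdist_lt _ _ _ (nbhs v)) => eps e0; pose c := 1 + \sum_i `|e i|.
  have c0 : 0 < c by rewrite ltr_pwDl // sumr_ge0.
  near=> w; apply: (le_lt_trans (ler_dist_dist _ _)).
  apply: (@le_lt_trans _ _ (`|v - w| * \sum_i `|e i|)).
    apply: linear_combination_dist => i.
    by have := coord_le_norm (v - w) i; rewrite !mxE.
  apply: (@le_lt_trans _ _ (`|v - w| * c)); first by rewrite ler_wpM2l // lerDr.
  rewrite -ltr_pdivlMr //; near: w.
  by apply: cvgr_dist_lt => //; rewrite divr_gt0.
pose S := [set v : 'rV[R]_(n + n) | `|v| = 1].
have S_compact : compact S.
  apply: bounded_closed_compact.
    exists 1; split => // M M1 v /= ->; exact: ltW.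
  rewrite (_ : S = (fun v : 'rV[R]_(n + n) => `|v|) @^-1` [set 1]) //.
  by apply: closed_comp => [v _|]; [exact: norm_continuous|exact: closed_eq].
have fE (t : (n + n).-tuple R) : f (\row_i tnth t i) = `|of_coords e t|.
  by congr `|_|; apply: eq_bigr => i _; rewrite mxE.
have [del d0 fS] : exists2 del, 0 < del & forall v, S v -> del <= f v.
  (* In dimension zero the sphere is empty and any positive bound will do. *)
  have [S0|S0] := pselect (S !=set0); last first.
    by exists 1 => // v Sv; case: S0; exists v.
  have [v Sv hv] := EVT_min_rV S0 S_compact (continuous_subspaceT f_cont).
  exists (f v) => [|w Sw]; last exact/hv/mem_set.
  rewrite lt_neqAle normr_ge0 andbT eq_sym; apply/eqP => fv0.
  have vE : v = \row_i tnth [tuple v ord0 i | i < n + n] i.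
    by apply/rowP => i; rewrite mxE tnth_mktuple.
  have := fv0; rewrite vE fE => /normr0_eq0/e_free z.
  move: Sv => /set_mem; rewrite /S /= vE (_ : \row_i _ = 0) ?normr0; last first.
    by apply/rowP => i; rewrite !mxE z.
  by move=> /eqP; rewrite eq_sym oner_eq0.
exists del^-1; first by rewrite invr_gt0.
move=> t i; pose v := \row_i tnth t i.
have coord_le : `|tnth t i| <= `|v|.
  by have := coord_le_norm v i; rewrite mxE.
have [v0|v_neq0] := eqVneq v 0.
  by rewrite (le_trans coord_le) // v0 normr0 mulr_ge0 // invr_ge0 ltW.
have v_gt0 : 0 < `|v| by rewrite normr_gt0.
apply: (le_trans coord_le); rewrite mulrC ler_pdivlMr // -fE -/v.
have Sv : S (`|v|^-1 *: v).
  by rewrite /S /= normrZ ger0_norm ?invr_ge0 // mulVf // gt_eqF.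
have := fS _ Sv; rewrite /f.
under eq_bigr do rewrite mxE -scalerA.
rewrite -scaler_sumr normrZ ger0_norm ?invr_ge0 // mulrC.
by rewrite ler_pdivlMr // mulrC.
Unshelve. all: by end_near. Qed.

End coordinates.

(** * Schwartz functions and the canonical maps *)

Section schwartz_square.
Context {R : realType} {n : nat} {Xi : normedModType R} (e : 'I_(n + n) -> Xi).

Lemma dXi_measure : exists mu : {measure set ((n + n).-tuple R) -> \bar R},
  (mu : set ((n + n).-tuple R) -> \bar R) = @dXi R n /\
  forall F, measurable_fun setT F -> (forall t, 0 <= F t)%E ->
    (\int[mu]_t F t = ((2 * pi) ^- n)%:E * \int[@lebesgue_tuple R (n + n)]_t F t)%E.
Proof.
have [nu nuE] := @lebesgue_tuple_measure R (n + n).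
have c0 : 0 <= (2 * pi) ^- n :> R by rewrite invr_ge0 exprn_ge0 // mulr_ge0 // pi_ge0.
exists (mscale (NngNum c0) nu); split.
  by apply/funext => E; rewrite /mscale /= /dXi -nuE.
by move=> F mF F0; rewrite -nuE ge0_integral_mscale.
Qed.

Lemma continuous_of_coords (w : Xi -> R) : continuous w ->
  forall t eps, 0 < eps -> exists2 del, 0 < del & forall t',
    (forall i, `|tnth t' i - tnth t i| < del) ->
    `|w (of_coords e t') - w (of_coords e t)| < eps.
Proof.
move=> cw t eps e0.
have /cvgrPdist_lt/(_ _ e0)/nbhs_normP[del /= d0 hdel] := cw (of_coords e t).
pose c := 1 + \sum_i `|e i|.
have c0 : 0 < c by rewrite ltr_pwDl // sumr_ge0.
exists (del / c); first by rewrite divr_gt0.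
move=> t' ht'; rewrite distrC; apply: hdel => /=; rewrite distrC.
apply: (@le_lt_trans _ _ (del / c * \sum_i `|e i|)).
  by apply: linear_combination_dist => i; exact/ltW/ht'.
rewrite mulrAC -mulrA gtr_pMr // ltr_pdivrMr // mul1r /c.
by rewrite ltrDr.
Qed.

Lemma schwartz_rnorm_continuous (h : 'S(Xi)) :
  continuous (fun X => rnorm (h X : R[i])).
Proof.
move=> X; have /asboolP[/(_ [::])[/(_ X tt) ch _] _] := valP h.
apply/(@cvgrPdist_lt _ _ _ (nbhs X)) => eps e0.
have /cvgrPdist_lt/(_ _ e0) := ch; apply: filterS => Y /=.
rewrite sub0r normrN ger0_norm ?rnorm_ge0 // => hY.
by rewrite distrC (le_lt_trans (ler_dist_rnorm _ _)).
Qed.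

Lemma integral_oneDsqrV :
  (\int[lebesgue_measure]_x ((oneDsqr x)^-1 : R)%:E = (pi : R)%:E)%E.
Proof.
rewrite ge0_symfun_integralT; last 3 first.
- by move=> x; rewrite invr_ge0.
- exact: continuous_oneDsqrV.
- by move=> x; rewrite /= /oneDsqr sqrrN.
rewrite -set_itvcy integral0y_oneDsqr -EFinM; congr EFin.
by rewrite mulrC divfK.
Qed.

Let square (h : 'S(Xi)) (t : (n + n).-tuple R) : R :=
  rnorm (h (of_coords e t) : R[i]) ^+ 2.

Lemma measurable_schwartz_square h : measurable_fun setT (square h).
Proof.
apply: measurable_funX; apply: measurable_tuple_continuous.
exact: continuous_of_coords (@schwartz_rnorm_continuous h).
Qed.

(** Each [1 + t_i^2] is at most a constant times [(1 + |X|)^2]. Decay of [h] of order [n + n]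
    therefore bounds its square by a multiple of the product of the [1 / (1 + t_i^2)], which has a
    finite integral. *)
Lemma schwartz_square_integrable h :
  (forall t, of_coords e t = 0 -> forall i, tnth t i = 0) ->
  (\int[@lebesgue_tuple R (n + n)]_t (square h t)%:E < +oo)%E.
Proof.
move=> e_free; have [C C0 hC] := coords_bounded e_free.
have /asboolP[_ rh] := valP h; have [c hc] := rh [::] (n + n)%N tt.
pose K := ((1 + C) ^+ (n + n) * c) ^+ 2.
have K_ge0 : 0 <= K by exact: sqr_ge0.
have square_le t : square h t <= K * \prod_i (oneDsqr (tnth t i))^-1.
  set X := of_coords e t; have pos_prod : 0 < \prod_i oneDsqr (tnth t i).
    by rewrite prodr_gt0 // => i _; exact: oneDsqr_gt0.
  rewrite prodfV ler_pdivlMr // /square -/X.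
  have le_prod : \prod_i oneDsqr (tnth t i) <= (((1 + C) * (1 + `|X|)) ^+ 2) ^+ (n + n).
    rewrite -[X in _ <= _ ^+ X]card_ord -prodr_const; apply: ler_prod => i _.
    rewrite (le_trans ler01) //=.
    have := hC t i; rewrite -/X /oneDsqr -(real_normK (num_real (tnth t i))).
    move: (normr_ge0 (tnth t i)) (normr_ge0 X).
    set a := `|tnth t i|; set b := `|X| => a0 b0 ab.
    (* Then [1 + a^2 <= (1 + a)^2 <= ((1 + C) * (1 + b))^2]. *)
    have : a <= (1 + C) * (1 + b) - 1 by nra.
    nra.
  have hX := hc X; rewrite /= -/X in hX.
  apply: (le_trans (ler_wpM2l (sqr_ge0 _) le_prod)).
  rewrite exprAC -exprMn /K ler_sqr ?nnegrE; last 2 first.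
  - by rewrite mulr_ge0 ?rnorm_ge0 // exprn_ge0 // mulr_ge0 ?addr_ge0 // ltW.
  - rewrite mulr_ge0 //; first by rewrite exprn_ge0 // addr_ge0 // ltW.
    by rewrite (le_trans _ hX) // mulr_ge0 ?rnorm_ge0 // exprn_ge0 // addr_ge0.
  rewrite exprMn mulrCA ler_wpM2l //; first by rewrite exprn_ge0 // addr_ge0 // ltW.
  by rewrite mulrC.
have [mu muE] := @lebesgue_tuple_measure R (n + n); rewrite -muE.
have mV : measurable_fun setT (fun t : (n + n).-tuple R => \prod_i (oneDsqr (tnth t i))^-1).
  apply: measurable_prod => i _.
  apply: (@measurableT_comp _ _ _ _ _ _ (fun x : R => (oneDsqr x)^-1)).
    by apply: continuous_measurable_fun; exact: continuous_oneDsqrV.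
  exact: measurable_tnth.
have V_ge0 (t : (n + n).-tuple R) : 0 <= \prod_i (oneDsqr (tnth t i))^-1.
  by rewrite prodr_ge0 // => i _; rewrite invr_ge0.
apply: (@le_lt_trans _ _ (\int[mu]_t (K * \prod_i (oneDsqr (tnth t i))^-1)%:E)%E).
  apply: ge0_le_integral => //.
  - by move=> t _; rewrite lee_fin sqr_ge0.
  - by apply/measurable_EFinP; exact: measurable_schwartz_square.
  - by apply/measurable_EFinP/measurable_funM.
  - by move=> t _; rewrite lee_fin.
under eq_integral do rewrite EFinM.
rewrite ge0_integralZl_EFin //; last 2 first.
- by move=> t _; rewrite lee_fin.
- exact/measurable_EFinP.
have := @lebesgue_tuple_prod R (n + n) (fun _ x => (oneDsqr x)^-1) (fun=> pi).
rewrite -muE => ->.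
- by rewrite -EFinM ltry.
- by move=> _; apply: continuous_measurable_fun; exact: continuous_oneDsqrV.
- by move=> _ x; rewrite invr_ge0.
- by move=> _; exact: integral_oneDsqrV.
Qed.

(** Spanning gives coordinates to a point where [h] does not vanish, and by continuity the norm of
    [h] stays above half its value there on a box of positive volume. *)
Lemma schwartz_square_integral_gt0 h :
  (forall X, exists c : 'I_(n + n) -> R, X = \sum_i c i *: e i) ->
  h <> 0 -> (0 < \int[@lebesgue_tuple R (n + n)]_t (square h t)%:E)%E.
Proof.
move=> e_span h0.
have [X hX] : exists X, (h X : R[i]) <> 0.
  apply/not_existsP => hh; apply: h0; apply: val_inj; apply/funext => X /=.
  by have := hh X => /contrapT.
have [c cX] := e_span X.
pose t0 := [tuple c i | i < n + n].
have t0X : of_coords e t0 = X.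
  by rewrite cX; apply: eq_bigr => i _; rewrite tnth_mktuple.
have pos : 0 < rnorm (h (of_coords e t0) : R[i]).
  rewrite t0X lt_neqAle rnorm_ge0 andbT eq_sym; apply/eqP => /rnorm0_eq0; exact: hX.
have [r r0 hr] := positive_on_box
  (continuous_of_coords (@schwartz_rnorm_continuous h)) pos.
have [mu muE] := @lebesgue_tuple_measure R (n + n).
set del := rnorm _ / 2 in hr.
have del0 : 0 < del by rewrite divr_gt0.
apply: (@lt_le_trans _ _ ((del ^+ 2 * (2 * r) ^+ (n + n))%:E)).
  by rewrite lte_fin mulr_gt0 // exprn_gt0 // mulr_gt0.
rewrite EFinM -(integral_box (tnth t0) r0) -muE -ge0_integralZl_EFin //; last 3 first.
- by move=> t _; rewrite lee_fin box_ge0.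
- by apply/measurable_EFinP; exact: measurable_box.
- exact: sqr_ge0.
apply: ge0_le_integral => //.
- by move=> t _; rewrite -EFinM lee_fin mulr_ge0 ?box_ge0 ?sqr_ge0.
- by apply/measurable_EFinP/measurable_funM => //; exact: measurable_box.
- by apply/measurable_EFinP; exact: measurable_schwartz_square.
- move=> t _; rewrite -EFinM lee_fin /box.
  case: (boolP [forall i, _]) => [/forallP ht|_]; last by rewrite mulr0 sqr_ge0.
  by rewrite mulr1 ler_sqr ?nnegrE ?rnorm_ge0 ?(ltW del0) // hr.
Qed.

End schwartz_square.

Section canonical_map_facts.
Context {R : realType} {n : nat} {Xi : normedModType R}.
Context (sigma : Xi -> Xi -> R) (e : 'I_(n + n) -> Xi).
Context {A : completeNormedModType R[i]} {SA : cstar_structure A}.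
Context (Theta : cstar_action Xi SA).
Hypothesis e_span : forall X, exists c : 'I_(n + n) -> R, X = \sum_i c i *: e i.
Hypothesis M_inj : injective (@Mmap R n Xi sigma e A SA Theta).

Lemma actZ X (c : R[i]) (f : A) : Theta X (c *: f) = c *: Theta X f.
Proof. by have := act_linear Theta X c f 0; rewrite act_zero !addr0. Qed.

Lemma act_inj X : injective (Theta X).
Proof.
by move=> f g fg; rewrite -(act0 Theta f) -(act0 Theta g) -(addNr X) !actD fg.
Qed.

Lemma act_rnorm_continuous (f : A) : continuous (fun X => rnorm (Theta X f)).
Proof.
move=> X; apply/(@cvgrPdist_lt _ _ _ (nbhs X)) => eps e0.
have e0' : 0 < eps%:C by rewrite -[0]/(0%:C) ltcR.
have /cvgrPdist_lt/(_ _ e0') := @act_continuous _ _ _ _ Theta f X.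
apply: filterS => Y; rewrite rnormE ltcR; exact: le_lt_trans (ler_dist_rnorm _ _).
Qed.

Lemma rnorm_expNi (s : R) : rnorm (expNi s) = 1.
Proof. by rewrite /rnorm normc_def /= sqrrN cos2Dsin2 sqrtr1. Qed.

Lemma Jmap_inj (h : 'S(Xi)) : h <> 0 -> injective (@Jmap R n Xi e A SA Theta h).
Proof.
move=> h0 f g fg.
have [X hX] : exists X, (h X : R[i]) != 0.
  apply/not_existsP => hh; apply: h0; apply: val_inj; apply/funext => X /=.
  by have := hh X => /negP; rewrite negbK => /eqP.
have : (h X : R[i]) *: f = (h X : R[i]) *: g.
  by have := congr1 (fun F : schwartz_ainf e Theta => F X) fg.
by move/(scalerI hX).
Qed.

(* Mmap takes the junk value 0 on every F whose defining integral diverges, so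
   its injectivity yields a convergent one among F and 2F. *)
Lemma Mmap_integral (h : 'S(Xi)) (f0 : ainf Theta) : h <> 0 -> f0 <> 0 ->
  exists2 f : ainf Theta, f <> 0 & exists v : A,
    is_integral e (fun Y => expNi (sigma 0 Y) *: Theta Y ((h Y : R[i]) *: (f : A))) v.
Proof.
move=> h0 f00; pose P (f : ainf Theta) (G : schwartz_ainf e Theta) := forall X,
  is_integral e (fun Y => expNi (sigma X Y) *: Theta Y (Jmap e h f Y : A)) (G X : A).
have [[G PG]|no1] := pselect (exists G, P f0 G).
  by exists f0 => //; exists (G 0 : A); exact: PG.
have f2 : 2%:R *: f0 <> 0 :> ainf Theta.
  by move/eqP; rewrite scaler_eq0 pnatr_eq0 /= => /eqP.
have [[G PG]|no2] := pselect (exists G, P (2%:R *: f0) G).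
  by exists (2%:R *: f0) => //; exists (G 0 : A); exact: PG.
have M0 f : ~ (exists G, P f G) -> Mmap sigma (Jmap e h f) = 0.
  by move=> no; apply: xgetPN => G PG; apply: no; exists G.
have : f0 = 2%:R *: f0 by apply/(Jmap_inj h0)/M_inj; rewrite !M0.
by rewrite scaler_nat mulr2n => /eqP; rewrite -subr_eq0 opprD addNKr oppr_eq0 => /eqP.
Qed.

Lemma basis_free (h : 'S(Xi)) (f0 : ainf Theta) : h <> 0 -> f0 <> 0 ->
  forall t, of_coords e t = 0 -> forall i, tnth t i = 0.
Proof.
move=> h0 /(Mmap_integral h0)[f f_neq0 [v intv]] u u0 i.
apply/eqP/negPn/negP => ui.
pose w X := rnorm (h X : R[i]) * rnorm (Theta X (f : A)).
have cw : continuous w.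
  by move=> X; apply: cvgM; [exact: schwartz_rnorm_continuous|exact: act_rnorm_continuous].
have cW := continuous_of_coords e cw.
have mW : measurable_fun setT (fun t => w (of_coords e t)) := measurable_tuple_continuous cW.
have w_ge0 X : 0 <= w X by rewrite mulr_ge0 ?rnorm_ge0.
have wE Y : rnorm (expNi (sigma 0 Y) *: Theta Y ((h Y : R[i]) *: (f : A))) = w Y.
  by rewrite rnormZ rnorm_expNi mul1r actZ rnormZ.
have [mu [muE mu_int]] := @dXi_measure R n.
have W_fin : (\int[@lebesgue_tuple R (n + n)]_t (w (of_coords e t))%:E < +oo)%E.
  have := intv; rewrite /is_integral -muE => /bochner_integral_norm_finite.
  under eq_fun do rewrite /= wE.
  move=> /(_ mW); under eq_integral do rewrite /= wE.
  rewrite mu_int; last 2 first.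
  - exact/measurable_EFinP.
  - by move=> t; rewrite lee_fin.
  have c0 : 0 < (2 * pi) ^- n :> R by rewrite invr_gt0 exprn_gt0 // mulr_gt0 // pi_gt0.
  (* An infinite Lebesgue integral would remain infinite after multiplication by the positive
     normalizing constant. *)
  case: (\int[_]_t _)%E => [r|//|//]; rewrite ?ltry //.
  by rewrite gt0_muley // lte_fin.
have W_inv t s : w (of_coords e [tuple tnth t i + s * tnth u i | i < n + n]) =
    w (of_coords e t).
  congr w; transitivity (of_coords e t + s *: of_coords e u); last first.
    by rewrite u0 scaler0 addr0.
  rewrite /of_coords scaler_sumr -big_split /=; apply: eq_bigr => j _.
  by rewrite tnth_mktuple scalerDl scalerA.
have W0 := translation_invariant_eq0 cW (fun t => w_ge0 _) ui W_inv W_fin.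
apply: h0; apply: val_inj; apply/funext => X /=.
have [c cX] := e_span X.
have := W0 [tuple c i | i < n + n].
rewrite (_ : of_coords _ _ = X); last first.
  by rewrite cX; apply: eq_bigr => j _; rewrite tnth_mktuple.
(* Of the two factors of [w X], the norm of [Theta X f] cannot vanish, as [Theta X] is injective and
   [f] is nonzero; hence [h] vanishes at every [X]. *)
move/eqP; rewrite mulf_eq0 => /orP[/eqP/rnorm0_eq0 //|/eqP/rnorm0_eq0 Tf].
case: f_neq0; apply: val_inj; apply: (@act_inj X).
by rewrite Tf act_zero.
Qed.

(** The choice made by [Minv] succeeds because [F] itself is a preimage, and injectivity identifies
    the chosen element with [F]. *)
Lemma MinvK F : Minv sigma (Mmap sigma F) = F :> schwartz_ainf e Theta.
Proof.
apply: M_inj; rewrite /Minv; case: xgetP => [G _ MG|no]; first exact: MG.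
by case: (no F).
Qed.

(** The integrand is the scalar function [|h|^2] times the fixed vector [f], so the constant is the
    squared L^2 norm of [h]. Uniqueness of Bochner integrals ensures that [xget] returns this
    value. *)
Lemma Jtilde_Jmap (h : 'S(Xi)) :
  (forall t, of_coords e t = 0 -> forall i, tnth t i = 0) -> h <> 0 ->
  exists2 c : R, 0 < c & forall f : ainf Theta,
    Jtilde h (Jmap e h f) = c%:C *: f.
Proof.
move=> e_free h0; have [mu [muE mu_int]] := @dXi_measure R n.
pose g t := rnorm (h (of_coords e t) : R[i]) ^+ 2.
have mg : measurable_fun setT g by exact: measurable_schwartz_square.
have g_int : (\int[mu]_t (g t)%:E =
    ((2 * pi) ^- n)%:E * \int[@lebesgue_tuple R (n + n)]_t (g t)%:E)%E.
  apply: mu_int; first exact/measurable_EFinP.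
  by move=> t; rewrite lee_fin sqr_ge0.
have c0 : 0 < (2 * pi) ^- n :> R by rewrite invr_gt0 exprn_gt0 // mulr_gt0 // pi_gt0.
have g_fin : (\int[mu]_t (g t)%:E < +oo)%E.
  rewrite g_int lte_mul_pinfty ?lee_fin ?(ltW c0) //.
  exact: schwartz_square_integrable.
have g_pos : (0 < \int[mu]_t (g t)%:E)%E.
  by rewrite g_int mule_gt0 ?lte_fin //; exact: schwartz_square_integral_gt0.
exists (fine (\int[mu]_t (g t)%:E)); first by rewrite fine_gt0 // g_pos g_fin.
move=> f; set c := fine _.
have int_cf : is_integral e (fun Y => ((h Y : R[i])^*)%C *: ((h Y : R[i]) *: (f : A)))
    (c%:C *: (f : A)).
  rewrite /is_integral -muE.
  rewrite (_ : _ \o _ = fun t => (g t)%:C *: (f : A)).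
    by apply: is_bochner_integral_scale => // t; exact: sqr_ge0.
  apply/funext => t; rewrite /= scalerA; congr (_ *: _).
  by rewrite /g rmorphXn /= -rnormE sqr_normc mulrC.
rewrite /Jtilde; case: xgetP => [v _ /= int_v|no].
  apply: val_inj; move: int_v int_cf; rewrite /is_integral -muE.
  exact: bochner_integral_unique.
by case: (no (c%:C *: f)).
Qed.

End canonical_map_facts.

(** * Domination of the norms and maps between the completions *)

Section main_estimate.
Context {R : realType} {n : nat} {Xi : normedModType R}.
Context (sigma : Xi -> Xi -> R) (e : 'I_(n + n) -> Xi).
Context {A : completeNormedModType R[i]} {SA : cstar_structure A}.
Context (Theta : cstar_action Xi SA).
Hypothesis e_span : forall X, exists c : 'I_(n + n) -> R, X = \sum_i c i *: e i.
Hypothesis M_inj : injective (@Mmap R n Xi sigma e A SA Theta).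
Context (N : schwartz_ainf e Theta -> R).

(** Boundedness of [Rmap] is tested on the vectors [Mh h f]. The norms are realized by linear maps
    [ih] and [ik] so that the scalar produced by [Jtilde] can be pulled out through the linearity of
    [ik]. *)
Lemma bounded_Rmap_domination (h k : 'S(Xi)) :
  h <> 0 -> bounded_op N (Rmap sigma k h) ->
  forall (Lh : normedModType R[i]) (ih : {linear ainf Theta -> Lh}),
    (forall f, rnorm (ih f) = normM sigma N h f) ->
  forall (Lk : normedModType R[i]) (ik : {linear ainf Theta -> Lk}),
    (forall f, rnorm (ik f) = normM sigma N k f) ->
  exists C, forall f, rnorm (ik f) <= C * rnorm (ih f).
Proof.
move=> h0 [C hC] Lh ih ihN Lk ik ikN.
(* Freeness of [e] is deduced from a nonzero smooth vector; if there is none, the estimate is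
   trivial. *)
have [[f0 f0_neq0]|triv] := pselect (exists f0 : ainf Theta, f0 <> 0); last first.
  exists 0 => f; have -> : f = 0 by apply: contrapT => f0; apply: triv; exists f.
  by rewrite linear0 rnormr0 mul0r.
have e_free := basis_free e_span M_inj h0 f0_neq0.
have [c c0 JJ] := Jtilde_Jmap Theta e_span e_free h0.
(* The bound at [Mh h f] reads [c * rnorm (ik f) <= C * rnorm (ih f)]. *)
exists (C / c) => f.
have := hC (Mh sigma e h f).
rewrite {1}/Rmap /= /Mtilde /Mh /= (MinvK M_inj) JJ -/(Mh sigma e k _).
rewrite -/(normM sigma N k _) -/(Mh sigma e h f) -/(normM sigma N h f) -ikN -ihN.
rewrite linearZ rnormZ rnorm_real gtr0_norm // => le.
by rewrite mulrAC ler_pdivlMr // mulrC.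
Qed.

(** A vector killed by [ik] has [Mh k] of norm zero, hence zero. Applied to [f - g] and to [0], this
    gives equal images under the injective map [Mh k]. *)
Lemma completion_inj (k : 'S(Xi)) (hN : is_norm N) : k <> 0 ->
  forall (Lk : normedModType R[i]) (ik : {linear ainf Theta -> Lk}),
    (forall f, rnorm (ik f) = normM sigma N k f) -> injective ik.
Proof.
move=> k0 Lk ik ikN f g fg.
have M0 f' : ik f' = 0 -> Mh sigma e k f' = 0.
  by move=> f'0; apply: (is_norm_eq0 hN); have := ikN f'; rewrite f'0 rnormr0.
apply/eqP; rewrite -subr_eq0; apply/eqP/(Jmap_inj k0)/M_inj.
have h1 := M0 (f - g); have h2 := M0 0.
rewrite /Mh /= in h1 h2; rewrite h1 ?h2 ?linear0 //.
by rewrite linearB fg subrr.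
Qed.

End main_estimate.

Lemma continuous_eq_dense {R : realType} (V : Type) (L L' : normedModType R[i])
    (i : V -> L) (S T : L -> L') :
  dense (range i) -> continuous S -> continuous T ->
  (forall x, S (i x) = T (i x)) -> S =1 T.
Proof.
move=> di cS cT ST y; apply/eqP; rewrite -subr_eq0; apply/eqP/rnorm_small_eq0 => eps e0.
have e2 : 0 < (eps / 2)%:C by rewrite -[0]/(0%:C) ltcR divr_gt0.
have /cvgrPdist_lt/(_ _ e2) nS := cS y.
have /cvgrPdist_lt/(_ _ e2) nT := cT y.
have /nbhs_ballP[_ /ltc_pos_real[r r0 ->] sub] : nbhs y (fun z =>
    `|S y - S z| < (eps / 2)%:C /\ `|T y - T z| < (eps / 2)%:C).
  exact: filterI.
have [x hx] := dense_range_approx di y r0.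
have [|/=] := sub (i x); first by rewrite -ball_normE /= rnormE ltcR rnormB.
rewrite !rnormE !ltcR -ST => h1 h2.
have -> : S y - T y = (S y - S (i x)) + (S (i x) - T y) by rewrite addrA subrK.
rewrite (le_trans (rnormD _ _)) // [leRHS]splitr; apply: lerD; first exact: ltW.
by rewrite rnormB; exact: ltW.
Qed.

Theorem proposition2p6 (R : realType) (n : nat) (Xi : normedModType R)
    (sigma : Xi -> Xi -> R) (e : 'I_(n + n) -> Xi)
    (hsigma : symplectic_form sigma) (he : symplectic_basis sigma e)
    (A : completeNormedModType R[i]) (SA : cstar_structure A)
    (Theta : cstar_action Xi SA)
    (hM : bijective (@Mmap R n Xi sigma e A SA Theta))
    (N : schwartz_ainf e Theta -> R) (hN : is_norm N) :
  (forall h k : 'S(Xi), h <> 0 -> k <> 0 ->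
    bounded_op N (Rmap sigma k h) ->
    forall (Lh : completeNormedModType R[i]) (ih : {linear ainf Theta -> Lh}),
      is_completion (normM sigma N h) ih ->
    forall (Lk : completeNormedModType R[i]) (ik : {linear ainf Theta -> Lk}),
      is_completion (normM sigma N k) ik ->
    exists T : {linear Lh -> Lk}, dense_embedding ih ik T) /\
  (admissible sigma N ->
    forall h k : 'S(Xi), h <> 0 -> k <> 0 ->
    forall (Lh : completeNormedModType R[i]) (ih : {linear ainf Theta -> Lh}),
      is_completion (normM sigma N h) ih ->
    forall (Lk : completeNormedModType R[i]) (ik : {linear ainf Theta -> Lk}),
      is_completion (normM sigma N k) ik ->
    exists T : {linear Lh -> Lk}, banach_iso ih ik T).
Proof.
have M_inj := bij_inj hM; have e_span := sympl_span he.
have ext (h k : 'S(Xi)) : h <> 0 -> bounded_op N (Rmap sigma k h) ->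
    forall (Lh : completeNormedModType R[i]) (ih : {linear ainf Theta -> Lh}),
      is_completion (normM sigma N h) ih ->
    forall (Lk : completeNormedModType R[i]) (ik : {linear ainf Theta -> Lk}),
      is_completion (normM sigma N k) ik ->
    exists T : {linear Lh -> Lk}, continuous T /\ forall f, T (ih f) = ik f.
  move=> h0 bR Lh ih [ihN dh] Lk ik [ikN dk].
  have [C hC] := bounded_Rmap_domination e_span M_inj h0 bR ihN ikN.
  exact: dense_linear_extension dh hC.
split=> [h k h0 k0 bR Lh ih ch Lk ik ck|adm h k h0 k0 Lh ih ch Lk ik ck].
  have [T [cT Ti]] := ext h k h0 bR Lh ih ch Lk ik ck.
  exists T; split=> //.
    move=> _ _ /set_mem[f _ <-] /set_mem[g _ <-]; rewrite !Ti.
    by move/(completion_inj M_inj hN k0 (completion_isometry ck)) ->.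
  (* The range of [T] contains that of [ik], which is already dense. *)
  move=> O O0 oO; have [z [Oz [f _ fz]]] := completion_dense ck O0 oO.
  by exists z; split=> //; exists (ih f) => //; rewrite Ti.
have [T [cT Ti]] := ext h k h0 (adm h k h0 k0) Lh ih ch Lk ik ck.
have [T' [cT' T'i]] := ext k h k0 (adm k h k0 h0) Lk ik ck Lh ih ch.
exists T; split=> //; exists T'; split=> //.
  (* Both composites are continuous and fix the dense copy of the smooth vectors, so they are
     identities. *)
  apply: (continuous_eq_dense (completion_dense ch) (S := T' \o T) (T := id)).
  - by move=> y; apply: continuous_comp; [exact: cT|exact: cT'].
  - by move=> y.
  - by move=> f /=; rewrite Ti T'i.
apply: (continuous_eq_dense (completion_dense ck) (S := T \o T') (T := id)).
- by move=> y; apply: continuous_comp; [exact: cT'|exact: cT].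
- by move=> y.
- by move=> f /=; rewrite T'i Ti.
Qed.
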